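(* Let $q$ be a prime power, $\mu=(\mu_1,\dots,\mu_\ell)$ a composition of $n$, $G=\mathrm{GL}_n(\mathbb{F}_q)$, and for $a\in M_\mu$ let $T_a=e_\mu v_ae_\mu\in\mathcal{H}_\mu$. For each $i$, let $\mathcal{H}_{(\mu_i)}$ be the algebra $\mathcal{H}_{(\mu_i)}=e_{(\mu_i)}\mathbb{C}\mathrm{GL}_{\mu_i}(\mathbb{F}_q)e_{(\mu_i)}$, with elements $T_{(f)}=e_{(\mu_i)}v_{(f)}e_{(\mu_i)}$ for $(f)\in M_{(\mu_i)}$. Then the linear map $$\mathcal{H}_{(\mu_1)}\otimes\cdots\otimes\mathcal{H}_{(\mu_\ell)}\to\mathcal{H}_\mu,\qquad T_{(f_1)}\otimes\cdots\otimes T_{(f_\ell)}\mapsto T_{\mathrm{diag}(f_1,\dots,f_\ell)}\quad((f_i)\in M_{(\mu_i)}),$$ is an injective algebra homomorphism whose image is $\mathcal{L}_\mu=e_\mu P_\mu e_\mu=e_\mu L_\mu e_\mu$ (the span of the elements $e_\mu pe_\mu$, $p\in P_\mu$, resp. $p\in L_\mu$).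
   Context: For any $m\ge1$: $U_m$ is the upper unitriangular subgroup of $\mathrm{GL}_m(\mathbb{F}_q)$, $x_{ij}(t)$ the identity with $t$ added at $(i,j)$, $\psi$ a fixed nontrivial character of $(\mathbb{F}_q,+)$. For a composition $\nu=(\nu_1,\dots,\nu_k)$ of $m$, $B_\nu=\{\nu_1,\nu_1+\nu_2,\dots,m\}$, $\psi_\nu:U_m\to\mathbb{C}^*$ is the linear character with $\psi_\nu(x_{i,i+1}(t))=\psi(t)$ if $i\notin B_\nu$ and $\psi_\nu(x_{ij}(t))=1$ for all other $i<j$, $e_\nu=\frac1{|U_m|}\sum_{u\in U_m}\psi_\nu(u^{-1})u$, and $\mathcal{H}_\nu=e_\nu\mathbb{C}\mathrm{GL}_m(\mathbb{F}_q)e_\nu$. In particular $\nu=(m)$ gives $\psi_{(m)}(x_{i,i+1}(t))=\psi(t)$ for all $i<m$. $M_\nu$ is the set of $k\times k$ matrices of monic polynomials $a_{ij}\in\mathbb{F}_q[X]$ with $a_{ij}(0)\ne0$, row degree sums $\sum_j\deg a_{ij}=\nu_i$ and column degree sums $\sum_i\deg a_{ij}=\nu_j$. So $M_{(m)}$ consists of $1\times1$ matrices $(f)$, $f$ monic of degree $m$ with $f(0)\ne0$. $w_{(k)}$ is the $k\times k$ antidiagonal permutation matrix; for monic $f=a_0+a_1X^{i_1}+\dots+a_rX^{i_r}+X^m$ ($0<i_1<\dots<i_r<m$, all $a_s\ne0$), $v_{(f)}=w_{(m)}(a_0w_{(i_1)}\oplus\dots\oplus a_rw_{(m-i_r)})$,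 and $v_{(1)}$ is empty. For $a\in M_\nu$, with $R_i=\nu_1+\dots+\nu_{i-1}$ and $d_{ij}=\deg a_{ij}$, $v_a$ is the $m\times m$ matrix having the block $v_{(a_{ij})}$ in rows $R_i+\sum_{s>j}d_{is}+1,\dots,R_i+\sum_{s\ge j}d_{is}$ and columns $R_j+\sum_{s>i}d_{sj}+1,\dots,R_j+\sum_{s\ge i}d_{sj}$, and zeros elsewhere. Here $\mathrm{diag}(f_1,\dots,f_\ell)\in M_\mu$ denotes the matrix with diagonal entries $f_i$ and all off-diagonal entries equal to the constant polynomial $1$; then $v_{\mathrm{diag}(f_1,\dots,f_\ell)}$ is the block diagonal matrix $v_{(f_1)}\oplus\dots\oplus v_{(f_\ell)}$. $P_\mu\subseteq G$ is the parabolic subgroup of block upper triangular matrices with diagonal blocks in $\mathrm{GL}_{\mu_1},\dots,\mathrm{GL}_{\mu_\ell}$, and $L_\mu$ its Levi subgroup of block diagonal matrices. *)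

(* Defs.v *)
From HB Require Import structures.
From mathcomp Require Import all_boot all_order all_algebra all_fingroup all_field.
From mathcomp Require Import boolp zify.

Set Implicit Arguments.
Unset Strict Implicit.
Unset Printing Implicit Defensive.

Import Order.TTheory GRing.Theory Num.Theory.
Local Open Scope ring_scope.

(** * Group algebras *)

(* [x g] is the coefficient of [g] in [x]. *)
Definition galg (K : fieldType) (gT : finGroupType) := {ffun gT -> K^o}.

Section GroupAlgebra.
Variables (K : fieldType) (gT : finGroupType).
Local Notation A := (galg K gT).

HB.instance Definition _ := Vector.copy A {ffun gT -> K^o}.

Definition gelt (g : gT) : A := [ffun h => (h == g)%:R].

Definition galg_mul (x y : A) : A :=
  [ffun g => \sum_(h : gT) x h * y (h^-1 * g)%g].

Lemma galgD (x y : A) g : (x + y) g = x g + y g.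
Proof. by rewrite ffunE. Qed.

Lemma galgZ (a : K) (x : A) g : (a *: x) g = a * x g.
Proof. by rewrite ffunE. Qed.

Lemma galg_sum I (r : seq I) (P : pred I) (x : I -> A) g :
  (\sum_(i <- r | P i) x i) g = \sum_(i <- r | P i) x i g.
Proof. by rewrite sum_ffunE. Qed.

Fact galg_mulA : associative galg_mul.
Proof.
move=> x y z; apply/ffunP=> g; rewrite !ffunE.
under eq_bigr do rewrite ffunE mulr_sumr.
under [RHS]eq_bigr do rewrite ffunE mulr_suml.
rewrite [RHS]exchange_big /=; apply: eq_bigr => h _.
rewrite (reindex (fun k => h^-1 * k)%g) /=; last first.
  by exists (mulg h) => k _; rewrite ?mulKg ?mulKVg.
by apply: eq_bigr => k _; rewrite mulrA invMg invgK -!mulgA mulKVg.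
Qed.

Fact galg_mul1 : left_id (gelt 1) galg_mul.
Proof.
move=> x; apply/ffunP=> g; rewrite ffunE (bigD1 1%g) //= ffunE eqxx mul1r.
by rewrite invg1 mul1g big1 ?addr0 // => h /negPf nh; rewrite ffunE nh mul0r.
Qed.

Fact galg_mulr1 : right_id (gelt 1) galg_mul.
Proof.
move=> x; apply/ffunP=> g; rewrite ffunE (bigD1 g) //= ffunE mulVg eqxx mulr1.
rewrite big1 ?addr0 // => h nh; rewrite ffunE -eq_invg_mul invgK.
by rewrite (negPf nh) mulr0.
Qed.

Fact galg_mulDl : left_distributive galg_mul +%R.
Proof.
move=> x y z; apply/ffunP=> g; rewrite !ffunE -big_split.
by apply: eq_bigr => h _; rewrite ffunE mulrDl.
Qed.

Fact galg_mulDr : right_distributive galg_mul +%R.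
Proof.
move=> x y z; apply/ffunP=> g; rewrite !ffunE -big_split.
by apply: eq_bigr => h _; rewrite ffunE mulrDr.
Qed.

Fact galg_1neq0 : gelt 1 != 0 :> A.
Proof.
by apply/eqP=> /ffunP/(_ 1%g)/eqP; rewrite !ffunE eqxx oner_eq0.
Qed.

HB.instance Definition _ := GRing.Zmodule_isNzRing.Build A
  galg_mulA galg_mul1 galg_mulr1 galg_mulDl galg_mulDr galg_1neq0.

Lemma galgM (x y : A) g : (x * y) g = \sum_(h : gT) x h * y (h^-1 * g)%g.
Proof. by rewrite [LHS]ffunE. Qed.

Fact galg_scaleAl (a : K) (x y : A) : a *: (x * y) = (a *: x) * y.
Proof.
apply/ffunP=> g; rewrite galgZ !galgM mulr_sumr.
by apply: eq_bigr => h _; rewrite galgZ mulrA.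
Qed.
HB.instance Definition _ := GRing.Lmodule_isLalgebra.Build K A galg_scaleAl.

Fact galg_scaleAr (a : K) (x y : A) : a *: (x * y) = x * (a *: y).
Proof.
apply/ffunP=> g; rewrite galgZ !galgM mulr_sumr.
by apply: eq_bigr => h _; rewrite galgZ mulrCA.
Qed.
HB.instance Definition _ := GRing.Lalgebra_isAlgebra.Build K A galg_scaleAr.
HB.instance Definition _ := Algebra_isFalgebra.Build K A.

Lemma gelt1 : gelt 1 = 1. Proof. by []. Qed.

Lemma geltM g h : gelt (g * h) = gelt g * gelt h.
Proof.
apply/ffunP=> k; rewrite galgM ffunE (bigD1 g) //= !ffunE eqxx mul1r.
rewrite big1 ?addr0 => [|i /negPf ni]; last by rewrite ffunE ni mul0r.
by rewrite -(inj_eq (mulgI g) _ h) mulKVg.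
Qed.

Lemma galg_expand (x : A) : x = \sum_g x g *: gelt g.
Proof.
apply/ffunP=> g; rewrite galg_sum (bigD1 g) //= galgZ ffunE eqxx mulr1.
rewrite big1 ?addr0 // => h /negPf nh.
by rewrite galgZ ffunE eq_sym nh mulr0.
Qed.

End GroupAlgebra.

(** * Corner algebras [e A e] *)

Section Corner.
Variables (K : fieldType) (A : falgType K) (e : A).

Definition corner : {vspace A} := limg (amulr e \o amull e)%VF.

Lemma mem_corner x : e * x * e \in corner.
Proof.
apply/memv_imgP; exists x; first exact: memvf.
by rewrite comp_lfunE !lfunE.
Qed.

Lemma cornerP x : reflect (exists y, x = e * y * e) (x \in corner).
Proof.
apply: (iffP idP) => [/memv_imgP[y _ ->]|[y ->]]; last exact: mem_corner.
by exists y; rewrite comp_lfunE !lfunE.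
Qed.

Hypotheses (ee : e * e = e) (e_neq0 : e != 0).

Fact corner_is_algid : is_algid e corner.
Proof.
split; first by have := mem_corner e; rewrite ee ee.
  exact: e_neq0.
by move=> _ /cornerP[y ->]; rewrite -!mulrA ee !mulrA ee.
Qed.

Fact corner_is_aspace : is_aspace corner.
Proof.
apply/andP; split; first by apply/has_algidP; exists e; apply: corner_is_algid.
apply/prodvP=> _ _ /cornerP[x ->] /cornerP[y ->]; apply/cornerP.
by exists (x * e * e * y); rewrite !mulrA.
Qed.

End Corner.

(** * Tensor product of a finite family of algebras *)

(* An element of the tensor product is given by its coordinates in the basis
   made of the pure tensors of elements of the bases [vbasis {: V i}]. It does
   not depend on these bases: see [tensor_universal] and [ptensM]. *)

Section Tensor.
Variables (K : fieldType) (I : finType) (V : I -> falgType K).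

Definition midx := fprod (fun i => 'I_(\dim {: V i})).
Definition tensor := {ffun midx -> K^o}.

HB.instance Definition _ := Vector.copy tensor {ffun midx -> K^o}.

Definition tcoord (x : forall i, V i) (J : midx) : K :=
  \prod_i coord (vbasis {: V i}) (J i) (x i).

Definition ptens (x : forall i, V i) : tensor := [ffun J => tcoord x J].

Definition tbasis (J : midx) (i : I) : V i := (vbasis {: V i})`_(J i).

Definition multilinear (W : lmodType K) (f : (forall i, V i) -> W) :=
  forall (x : forall i, V i) (i : I) (a : K) (u v : V i),
    f (dfwith x (a *: u + v)) = a *: f (dfwith x u) + f (dfwith x v).

Lemma tensorD (s t : tensor) J : (s + t) J = s J + t J.
Proof. by rewrite ffunE. Qed.

Lemma tensorZ (a : K) (s : tensor) J : (a *: s) J = a * s J.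
Proof. by rewrite ffunE. Qed.

Lemma tensor_sum (X : Type) (r : seq X) (P : pred X) (s : X -> tensor) J :
  (\sum_(i <- r | P i) s i) J = \sum_(i <- r | P i) s i J.
Proof. by rewrite sum_ffunE. Qed.

Lemma midx_distr (c : forall i, 'I_(\dim {: V i}) -> K) :
  \prod_i \sum_j c i j = \sum_(J : midx) \prod_i c i (J i).
Proof.
pose P i := [ffun j => c i j].
transitivity (\prod_i \sum_j P i j).
  by apply: eq_bigr => i _; apply: eq_bigr => j _; rewrite ffunE.
transitivity (\sum_(J : midx) \prod_i P i (J i)); last first.
  by apply: eq_bigr => J _; apply: eq_bigr => j _; rewrite ffunE.
rewrite (@big_fprod K 0 1 *%R +%R I _ P).
under eq_bigr do rewrite (big_tag (fun i => P i)).
by rewrite bigA_distr_big_dep.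
Qed.

Lemma coord_tbasis J L i :
  coord (vbasis {: V i}) (L i) (tbasis J i) = (J i == L i)%:R.
Proof. by rewrite coord_free ?(basis_free (vbasisP _)). Qed.

Lemma ptens_tbasis J : ptens (tbasis J) = [ffun L => (L == J)%:R].
Proof.
apply/ffunP=> L; rewrite !ffunE /tcoord.
under eq_bigr do rewrite coord_tbasis.
have [->|nLJ] := eqVneq L J; first by rewrite big1 // => i _; rewrite eqxx.
have [i niLJ] : exists i, J i != L i.
  apply/existsP; rewrite -negb_forall; apply: contra nLJ => /forallP eqJL.
  by apply/eqP/fprodP => i; apply/esym/eqP/eqJL.
by rewrite (bigD1 i) //= (negPf niLJ) mul0r.
Qed.

Lemma tensor_expand (s : tensor) : s = \sum_J s J *: ptens (tbasis J).
Proof.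
apply/ffunP=> L; rewrite tensor_sum (bigD1 L) //= tensorZ ptens_tbasis.
rewrite ffunE eqxx mulr1 big1 ?addr0 // => J /negPf nJ.
by rewrite tensorZ ptens_tbasis ffunE eq_sym nJ mulr0.
Qed.

Lemma ptens_multilinear : multilinear ptens.
Proof.
move=> x i a u v; apply/ffunP=> J; rewrite tensorD tensorZ !ffunE /tcoord.
rewrite !(bigD1 (P := predT) i) //= !dfwith_in linearP mulrDl mulrA.
by congr (_ * _ + _ * _); apply: eq_bigr => j ji; rewrite !dfwith_out // eq_sym.
Qed.

Lemma multilinear_eq0 (W : lmodType K) (f : (forall i, V i) -> W) :
  multilinear f -> (forall J, f (tbasis J) = 0) -> forall x, f x = 0.
Proof.
move=> mf f0 x.
suff H (s : seq I) y : (forall i, i \notin s -> exists j : 'I_(\dim {: V i}),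
    y i = (vbasis {: V i})`_j) -> f y = 0.
  by apply: (H (enum I)) => i; rewrite mem_enum.
elim: s y => [|i s IHs] y yP.
  have /all_sig[J JP] i : {j : 'I_(\dim {: V i}) | y i = (vbasis {: V i})`_j}.
    by apply: cid; apply: yP.
  have -> : y = tbasis (fprod_of_fun J); last exact: f0.
  by apply: functional_extensionality_dep => i; rewrite /tbasis fprodE.
have fz : f (dfwith y (0 : V i)) = 0.
  have := mf y i (-1) 0 0; rewrite scaler0 addr0 scaleN1r addNr; exact.
have -> : y = dfwith y (y i).
  apply: functional_extensionality_dep => j.
  by have [<-|ji] := eqVneq i j; rewrite ?dfwith_in ?dfwith_out.
rewrite [y i](coord_vbasis (memvf _)).
apply: (big_ind (fun u => f (dfwith y u) = 0)) => //.
  by move=> u v fu fv; rewrite -[u]scale1r mf fu fv scaler0 addr0.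
move=> j _; rewrite -[_ *: _]addr0 mf fz addr0.
rewrite (IHs (dfwith y (vbasis {: V i})`_j)) ?scaler0 // => k.
case: dfwithP => [|l il ls]; first by exists j.
by apply: yP; rewrite inE eq_sym (negPf il).
Qed.

Lemma multilinear_expand (W : lmodType K) (f : (forall i, V i) -> W) :
  multilinear f -> forall x, f x = \sum_J ptens x J *: f (tbasis J).
Proof.
move=> mf x; apply/eqP; rewrite -subr_eq0; apply/eqP.
pose g y := f y - \sum_J ptens y J *: f (tbasis J).
apply: (@multilinear_eq0 _ g) => [y i a u v|J]; rewrite /g; last first.
  rewrite (bigD1 J) //= ptens_tbasis ffunE eqxx scale1r big1 ?addr0 ?subrr //.
  by move=> L /negPf nL; rewrite ffunE nL scale0r.
rewrite mf ptens_multilinear scalerBr scaler_sumr addrACA -opprD -big_split.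
congr (_ - _); apply: eq_bigr => J _ /=.
by rewrite tensorD tensorZ scalerDl scalerA.
Qed.

Theorem tensor_universal (W : lmodType K) (f : (forall i, V i) -> W) :
  multilinear f ->
  exists phi : {linear tensor -> W}, (forall x, phi (ptens x) = f x) /\
    forall phi' : {linear tensor -> W},
      (forall x, phi' (ptens x) = f x) -> phi' =1 phi.
Proof.
move=> mf; pose phi (s : tensor) := \sum_J s J *: f (tbasis J).
have phi_lin : linear phi.
  move=> a s t; rewrite /phi scaler_sumr -big_split; apply: eq_bigr => J _ /=.
  by rewrite tensorD tensorZ scalerDl scalerA.
pose phiL := GRing.isLinear.Build K tensor W *:%R phi phi_lin.
pose Phi : {linear tensor -> W} := HB.pack phi phiL.
exists Phi; split=> [x|phi' phi'P s] /=.
  exact/esym/multilinear_expand.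
rewrite {1}[s]tensor_expand linear_sum; apply: eq_bigr => J _.
by rewrite linearZ phi'P.
Qed.

Definition tensor_one : tensor := ptens (fun i => 1).

Definition tensor_mul (s t : tensor) : tensor :=
  \sum_J \sum_L (s J * t L) *: ptens (fun i => tbasis J i * tbasis L i).

Fact tensor_mul_ptens x y :
  tensor_mul (ptens x) (ptens y) = ptens (fun i => x i * y i).
Proof.
apply/ffunP=> M; rewrite tensor_sum ffunE.
under eq_bigr do rewrite tensor_sum.
pose cx i j := coord (vbasis {: V i}) j (x i).
pose cy i j := coord (vbasis {: V i}) j (y i).
pose cc i j k : K := coord (vbasis {: V i}) (M i)
  ((vbasis {: V i})`_j * (vbasis {: V i})`_k).
transitivity (\prod_i \sum_j \sum_k cx i j * cy i k * cc i j k).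
  rewrite midx_distr; apply: eq_bigr => J _.
  rewrite midx_distr; apply: eq_bigr => L _.
  by rewrite tensorZ !ffunE -!big_split.
apply: eq_bigr => i _.
rewrite [x i](coord_vbasis (memvf _)) [y i](coord_vbasis (memvf _)).
rewrite mulr_suml linear_sum; apply: eq_bigr => j _.
rewrite mulr_sumr linear_sum; apply: eq_bigr => k _.
by rewrite -scalerAl -scalerAr !linearZ /= mulrA.
Qed.

Fact tensor_mulDl : left_distributive tensor_mul +%R.
Proof.
move=> s t u; rewrite -big_split; apply: eq_bigr => J _ /=.
rewrite -big_split; apply: eq_bigr => L _ /=.
by rewrite tensorD mulrDl scalerDl.
Qed.

Fact tensor_mulDr : right_distributive tensor_mul +%R.
Proof.
move=> s t u; rewrite -big_split; apply: eq_bigr => J _ /=.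
rewrite -big_split; apply: eq_bigr => L _ /=.
by rewrite tensorD mulrDr scalerDl.
Qed.

Fact tensor_scaleAl (a : K) s t :
  a *: tensor_mul s t = tensor_mul (a *: s) t.
Proof.
rewrite scaler_sumr; apply: eq_bigr => J _.
rewrite scaler_sumr; apply: eq_bigr => L _.
by rewrite scalerA tensorZ mulrA.
Qed.

Fact tensor_scaleAr (a : K) s t :
  a *: tensor_mul s t = tensor_mul s (a *: t).
Proof.
rewrite scaler_sumr; apply: eq_bigr => J _.
rewrite scaler_sumr; apply: eq_bigr => L _.
by rewrite scalerA tensorZ mulrCA.
Qed.

Lemma tensor_ind (P : tensor -> Prop) :
  (forall s t, P s -> P t -> P (s + t)) ->
  (forall a x, P (a *: ptens x)) -> forall s, P s.
Proof.
move=> PD PZ s; rewrite [s]tensor_expand; apply: (big_ind P) => //.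
by have := PZ 0 (fun=> 0); rewrite scale0r.
Qed.

Fact tensor_mulA : associative tensor_mul.
Proof.
move=> s t u.
elim/tensor_ind: s => [s1 s2 IH1 IH2|a x]; first by rewrite !tensor_mulDl IH1 IH2.
rewrite -!tensor_scaleAl; congr (_ *: _).
elim/tensor_ind: t => [s1 s2 IH1 IH2|b y].
  by rewrite tensor_mulDl !tensor_mulDr tensor_mulDl IH1 IH2.
rewrite -!tensor_scaleAl -!tensor_scaleAr -tensor_scaleAl; congr (_ *: _).
elim/tensor_ind: u => [s1 s2 IH1 IH2|c z].
  by rewrite !tensor_mulDr IH1 IH2.
rewrite -!tensor_scaleAr !tensor_mul_ptens; congr (_ *: ptens _).
by apply: functional_extensionality_dep => i; rewrite mulrA.
Qed.

Fact tensor_mul1 : left_id tensor_one tensor_mul.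
Proof.
elim/tensor_ind => [s t IHs IHt|a x]; first by rewrite tensor_mulDr IHs IHt.
rewrite -tensor_scaleAr tensor_mul_ptens; congr (_ *: ptens _).
by apply: functional_extensionality_dep => i; rewrite mul1r.
Qed.

Fact tensor_mulr1 : right_id tensor_one tensor_mul.
Proof.
elim/tensor_ind => [s t IHs IHt|a x]; first by rewrite tensor_mulDl IHs IHt.
rewrite -tensor_scaleAl tensor_mul_ptens; congr (_ *: ptens _).
by apply: functional_extensionality_dep => i; rewrite mulr1.
Qed.

Fact tensor_1neq0 : tensor_one != 0.
Proof.
have /all_sig[J JP] i :
    {j : 'I_(\dim {: V i}) | coord (vbasis {: V i}) j 1 != 0}.
  apply/sigW/existsP; rewrite -negb_forall; apply: contra (oner_neq0 (V i)).
  move/forallP=> c0; rewrite [1](coord_vbasis (memvf _)) big1 // => j _.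
  by rewrite (eqP (c0 j)) scale0r.
apply/eqP=> /ffunP/(_ (fprod_of_fun J))/eqP; rewrite !ffunE.
by apply/negP/prodf_neq0 => i _; rewrite fprodE.
Qed.

HB.instance Definition _ := GRing.Zmodule_isNzRing.Build tensor
  tensor_mulA tensor_mul1 tensor_mulr1 tensor_mulDl tensor_mulDr tensor_1neq0.
HB.instance Definition _ :=
  GRing.Lmodule_isLalgebra.Build K tensor tensor_scaleAl.
HB.instance Definition _ :=
  GRing.Lalgebra_isAlgebra.Build K tensor tensor_scaleAr.
HB.instance Definition _ := Algebra_isFalgebra.Build K tensor.

Lemma ptensM x y : ptens x * ptens y = ptens (fun i => x i * y i).
Proof. exact: tensor_mul_ptens. Qed.

Lemma ptens1 : ptens (fun i => 1) = 1. Proof. by []. Qed.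

End Tensor.
(** * Unitriangular matrices and their linear characters *)

(* Matrices and compositions are indexed from 0. Since [{'GL_m[F]}] consists of
   matrices of size [m.-1.+1], it is only meaningful for [0 < m]. *)

Section Unitriangular.
Variables (F : finFieldType) (m : nat).
Local Notation GL := {'GL_m[F]}.
Implicit Types u v : GL.

Definition unitri : {set GL} :=
  
  [set u : GL | [forall i : 'I_m.-1.+1, forall j : 'I_m.-1.+1,
                   (j <= i)%N ==> (u i j == (i == j)%:R)]].

Lemma unitriP u :
  reflect (forall i j : 'I_m.-1.+1, (j <= i)%N -> u i j = (i == j)%:R) (u \in unitri).
Proof.
rewrite inE; apply: (iffP forallP) => [H i j ji|H i].
  by have /forallP/(_ j)/implyP/(_ ji)/eqP := H i.
by apply/forallP=> j; apply/implyP=> ji; rewrite H.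
Qed.

Lemma unitri_mulE u v i j : u \in unitri -> v \in unitri ->
  GLval (u * v) i j = \sum_(k < m.-1.+1 | (i <= k <= j)%N) u i k * v k j.
Proof.
move=> /unitriP uU /unitriP vU; rewrite GL_MxE mxE [RHS]big_mkcond /=.
apply: eq_bigr => k _; case: leqP => [ik|ki] /=; last first.
  by rewrite uU 1?ltnW // -val_eqE gtn_eqF // mul0r.
case: leqP => [//|jk]; by rewrite vU 1?ltnW // -val_eqE gtn_eqF // mulr0.
Qed.

Fact unitri_group_set : group_set unitri.
Proof.
apply/group_setP; split.
  by apply/unitriP=> i j _; rewrite GL_1E mxE.
move=> u v uU vU; apply/unitriP=> i j ji; rewrite unitri_mulE //.
have [->|nij] := eqVneq i j.
  rewrite (big_pred1 j) => [|k]; last by rewrite -eqn_leq eq_sym.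
  by rewrite (unitriP _ uU) // (unitriP _ vU) // eqxx mulr1.
rewrite big_pred0 // => k; apply/negP=> /andP[ik kj].
by case/eqP: nij; apply/val_inj/eqP; rewrite eqn_leq ji (leq_trans ik kj).
Qed.
Canonical unitri_group := Group unitri_group_set.

(* For [i = j] this is the junk value [1]. *)
Definition xroot (i j : 'I_m.-1.+1) (t : F) : GL :=
  insubd (1%g : GL) (1%:M + t *: delta_mx i j).

Lemma xrootE i j t : i != j -> GLval (xroot i j t) = 1%:M + t *: delta_mx i j.
Proof.
move=> ij; rewrite /xroot [LHS]insubdK //.
suff /mulmx1_unit[]: (1%:M + t *: delta_mx i j) *m (1%:M - t *: delta_mx i j)
  = 1%:M :> 'M[F]_m.-1.+1 by [].
rewrite mulmxDl mulmxBr mulmx1 mul1mx mulmxBr mulmx1.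
rewrite -scalemxAl -scalemxAr mul_delta_mx_0 1?eq_sym // !scaler0 subr0.
by rewrite subrK.
Qed.

Lemma xroot_unitri (i j : 'I_m.-1.+1) t : (i < j)%N -> xroot i j t \in unitri.
Proof.
move=> ij; apply/unitriP => k l lk.
have nij : i != j by rewrite -val_eqE ltn_eqF.
rewrite xrootE // !mxE.
case: (k =P i) lk => [->|_]; case: (l =P j) => [->|_] lk /=;
  rewrite ?mulr0 ?addr0 //.
by rewrite leqNgt ij in lk.
Qed.

End Unitriangular.

Record addchar (F : finFieldType) (C : numFieldType) := AddChar {
  addchar_fun :> F -> C;
  addchar0 : addchar_fun 0 = 1;
  addcharD : {morph addchar_fun : s t / s + t >-> s * t}
}.

(* The set [B_nu] of partial sums of [nu]. *)
Definition psums (nu : seq nat) : seq nat := scanl addn 0%N nu.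

Section WhittakerIdempotent.
Variables (F : finFieldType) (C : numFieldType) (psi : addchar F C).
Variables (m : nat) (nu : seq nat).
Local Notation GL := {'GL_m[F]}.
Local Notation U := (unitri F m).
Implicit Types u v : GL.

(* The linear character [psi_nu], extended by the same formula outside [U];
   see [psinuM], [psinu_xroot] and [psinu_unique]. *)
Definition psinu u : C :=
  psi (\sum_(i < m.-1.+1) \sum_(j < m.-1.+1 |
         (j == i.+1 :> nat) && (i.+1 \notin psums nu)) u i j).

Lemma psinu1 : psinu 1 = 1.
Proof.
rewrite /psinu big1 ?addchar0 // => i _; rewrite big1 // => j /andP[/eqP ji _].
by rewrite GL_1E mxE -val_eqE /= ji ltn_eqF.
Qed.

Lemma psinuM : {in U &, {morph psinu : u v / (u * v)%g >-> u * v}}.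
Proof.
move=> u v uU vU; rewrite /psinu -addcharD -big_split; congr (psi _).
apply: eq_bigr => i _ /=; rewrite -big_split; apply: eq_bigr => j.
case/andP=> /eqP ji _ /=; rewrite unitri_mulE //.
have nij : i != j by rewrite -val_eqE /= ji ltn_eqF.
have ii : (i <= i <= j)%N by rewrite leqnn ji leqnSn.
have jj : (i <= j <= j)%N && (j != i) by rewrite eq_sym nij leqnn ji leqnSn.
rewrite (bigD1 i) //= (bigD1 j) //=.
rewrite big_pred0 => [|k]; last first.
  apply/negP=> /andP[/andP[/andP[ik kj] nki] nkj].
  move: ik kj nki nkj; rewrite -!val_eqE /= ji => ik ki1 nki nkj.
  by case/eqP: nki; apply/eqP; rewrite eqn_leq ik -ltnS ltn_neqAle nkj ki1.
rewrite addr0 (unitriP _ uU i i) // (unitriP _ vU j j) // !eqxx mul1r mulr1.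
exact: addrC.
Qed.

Lemma psinu_xroot (i j : 'I_m.-1.+1) t : (i < j)%N ->
  psinu (xroot i j t) =
    if (j == i.+1 :> nat) && (i.+1 \notin psums nu) then psi t else 1.
Proof.
move=> ij; rewrite /psinu.
have nij : i != j by rewrite -val_eqE ltn_eqF.
have xE (k l : 'I_m.-1.+1) : l = k.+1 :> nat ->
    xroot i j t k l = t *+ ((k == i) && (l == j)).
  move=> lk; rewrite xrootE // !mxE -[k == l]val_eqE /= lk ltn_eqF // add0r.
  by rewrite mulr_natr.
under eq_bigr do under eq_bigr => l /andP[/eqP lk _] do rewrite xE //.
have Z k : k != i -> \sum_(l < m.-1.+1 | (l == k.+1 :> nat)
    && (k.+1 \notin psums nu)) t *+ ((k == i) && (l == j)) = 0.
  by move/negPf=> ->; rewrite big1.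
rewrite (bigD1 i) //= [X in _ + X]big1 ?addr0; last by move=> k; apply: Z.
rewrite eqxx /=; case: ifP => [H|nH].
  rewrite (bigD1 j) //= eqxx big1 ?addr0 // => l /andP[_ /negPf ->].
  by rewrite mulr0n.
rewrite big1 ?addchar0 // => l lP.
by have [lj|_] := eqVneq l j; rewrite ?mulr0n //; rewrite lj nH in lP.
Qed.

Lemma psinu_unique (chi : GL -> C) :
  chi 1%g = 1 -> {in U &, {morph chi : u v / (u * v)%g >-> u * v}} ->
  (forall (i j : 'I_m.-1.+1) t, (i < j)%N -> chi (xroot i j t) =
     if (j == i.+1 :> nat) && (i.+1 \notin psums nu) then psi t else 1) ->
  {in U, chi =1 psinu}.
Proof.
move=> chi1 chiM chix u.
pose off v := [set p : 'I_m.-1.+1 * 'I_m.-1.+1 |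
  (p.1 < p.2)%N && (v p.1 p.2 != 0)].
have [n] := ubnP #|off u|; elim: n u => // n IHn u un uU.
have [off0|[p0 p0u]] := set_0Vmem (off u).
  suff -> : u = 1%g by rewrite chi1 psinu1.
  apply/val_inj/matrixP=> i j; rewrite /= mxE; case: (leqP j i) => [|ij].
    by move/(unitriP _ uU).
  have: (i, j) \notin off u by rewrite off0 inE.
  by rewrite inE /= ij negbK => /eqP ->; rewrite -val_eqE /= ltn_eqF.
have [[i j] /= ij_u jmin] := @arg_minnP _ p0 (mem (off u)) (fun p => p.2) p0u.
have := ij_u; rewrite inE /= => /andP[ij uij].
have nij : i != j by rewrite -val_eqE ltn_eqF.
set x := xroot i j (GLval u i j); set y := xroot i j (- GLval u i j).
have [xU yU] : x \in U /\ y \in U by split; apply: xroot_unitri.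
have yx : (y * x = 1)%g.
  apply: val_inj; change (GLval y *m GLval x = 1%:M); rewrite !xrootE //.
  rewrite mulmxDl mulmxDr mulmx1 mul1mx mulmxDr mulmx1.
  rewrite -scalemxAl -scalemxAr mul_delta_mx_0 1?eq_sym // !scaler0 addr0.
  by rewrite scaleNr addrK.
have def_u : u = (u * y * x)%g by rewrite -mulgA yx mulg1.
have uyE k l : GLval (u * y) k l =
    GLval u k l - GLval u i j * (GLval u k i * (l == j)%:R).
  rewrite GL_MxE xrootE // mulmxDr mulmx1 -scalemxAr scaleNr !mxE.
  congr (_ - _ * _); rewrite (bigD1 i) //= big1 ?addr0 => [|h nh].
    by rewrite mxE eqxx.
  by rewrite mxE (negPf nh) mulr0.
have ui k : GLval u k i = (k == i)%:R.
  case: (leqP i k) => [/(unitriP _ uU) //|ki].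
  rewrite -val_eqE ltn_eqF //; apply: contraTeq ij => uki.
  by rewrite -leqNgt (jmin (k, i)) // inE /= ki.
have uyU : (u * y)%g \in U by rewrite groupM.
rewrite def_u chiM // psinuM // IHn //; last first.
  rewrite -ltnS; apply: leq_trans un; rewrite ltnS; apply: proper_card.
  apply/properP; split; last first.
    by exists (i, j); rewrite // inE /= uyE ui !eqxx !mulr1 subrr eqxx andbF.
  apply/subsetP=> -[k l]; rewrite !inE /= uyE ui => /andP[->] /=.
  case: (eqVneq k i) => [->|_]; last by rewrite mul0r mulr0 subr0.
  by case: (eqVneq l j) => [->|_]; rewrite ?mulr0 ?subr0 // !mulr1 subrr eqxx.
by rewrite chix // psinu_xroot.
Qed.

Definition eidem : galg C GL :=
  (#|U|%:R)^-1 *: \sum_(u in U) psinu u^-1 *: gelt C u.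

Lemma psinuV u : u \in U -> psinu u * psinu u^-1 = 1.
Proof. by move=> uU; rewrite -psinuM ?groupV // mulgV psinu1. Qed.

Lemma card_unitri_neq0 : #|U|%:R != 0 :> C.
Proof. by rewrite pnatr_eq0 -lt0n (cardG_gt0 (unitri_group F m)). Qed.

Lemma gelt_eidem u : u \in U -> gelt C u * eidem = psinu u *: eidem.
Proof.
move=> uU; rewrite -scalerAr scalerA mulrC -scalerA; congr (_ *: _).
rewrite mulr_sumr scaler_sumr (reindex (mulg u^-1)) /=; last first.
  by exists (mulg u) => v _; rewrite ?mulKg ?mulKVg.
apply: eq_big => [v|v vU]; first by rewrite groupMl ?groupV.
rewrite -scalerAr -geltM mulKVg invMg invgK.
rewrite groupMl ?groupV // in vU.
by rewrite psinuM ?groupV // scalerA mulrC.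
Qed.

Lemma eidem_idem : eidem * eidem = eidem.
Proof.
rewrite {1}/eidem -scalerAl mulr_suml.
under eq_bigr => u uU do
  rewrite -scalerAl gelt_eidem // scalerA mulrC psinuV // scale1r.
by rewrite sumr_const -scaler_nat scalerA mulVf ?scale1r ?card_unitri_neq0.
Qed.

Lemma eidem_neq0 : eidem != 0.
Proof.
apply/eqP=> /ffunP/(_ 1%g)/eqP; rewrite galgZ galg_sum ffunE (bigD1 1%g) //=.
rewrite galgZ ffunE eqxx mulr1 invg1 psinu1 big1 ?addr0 => [|u /andP[_ nu1]].
  by rewrite mulr1 invr_eq0 (negPf card_unitri_neq0).
by rewrite galgZ ffunE eq_sym (negPf nu1) mulr0.
Qed.

(* The unit of this algebra is [eidem], see [corner_is_algid]. *)
Definition hecke : {aspace galg C GL} :=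
  ASpace (corner_is_aspace eidem_idem eidem_neq0).

Definition heckeA : falgType C := subvs_of hecke.

Lemma heckeA1 : vsval (1 : heckeA) = eidem.
Proof.
have [e_H _ eid] := corner_is_algid eidem_idem eidem_neq0.
have [e_alg _] := eid _ (memv_algid hecke).
transitivity (eidem * algid hecke); first by rewrite e_alg.
exact: (@algidr _ _ hecke).
Qed.

Lemma mem_hecke (x : galg C GL) : eidem * x * eidem \in hecke.
Proof. exact: mem_corner. Qed.

Definition heckeElt (g : GL) : heckeA := Subvs (mem_hecke (gelt C g)).

(* The span of the elements [e_nu g e_nu], for [g] in [X]. *)
Definition hecke_span (X : {set GL}) : {vspace heckeA} :=
  <<[seq heckeElt g | g in X]>>%VS.

End WhittakerIdempotent.

(** * The matrices [v_a] *)

Definition is_composition (n : nat) (nu : seq nat) : bool :=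
  all (fun k => 0 < k)%N nu && (sumn nu == n).

Definition deg (R : nzRingType) (f : {poly R}) : nat := (size f).-1.

Section MonomialMatrices.
Variable F : finFieldType.
Implicit Types f : {poly F}.

Definition inM (nu : seq nat) (a : 'M[{poly F}]_(size nu)) : Prop :=
  [/\ forall i j, a i j \is monic,
      forall i j, (a i j).[0] != 0,
      forall i, (\sum_j deg (a i j) = nth 0 nu i)%N
    & forall j, (\sum_i deg (a i j) = nth 0 nu j)%N].

(* The exponents [0 = i_0 < i_1 < ... < i_r < m] and [m] of [f]. *)
Definition expts f : seq nat := [seq i <- iota 0 (size f) | f`_i != 0].

(* The entry [(r, c)] of the direct sum of the matrices [f`_b.1 w_(b.2 - b.1)],
   for [b] the pairs of consecutive exponents of [f]. *)
Definition antidiag_sum f (r c : nat) : F :=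
  \sum_(b <- zip (expts f) (behead (expts f)))
    if [&& (b.1 <= r < b.2)%N, (b.1 <= c < b.2)%N
         & (r - b.1) + (c - b.1) == (b.2 - b.1).-1]%N then f`_b.1 else 0.

(* Multiplication by [w_(m)] on the left reverses the order of the rows. *)
Definition vpoly f (r c : nat) : F := antidiag_sum f ((deg f).-1 - r)%N c.

Section Blocks.
Variables (nu : seq nat) (a : 'M[{poly F}]_(size nu)).

Definition row_start (i j : 'I_(size nu)) : nat :=
  (sumn (take i nu) + \sum_(s < size nu | j < s) deg (a i s))%N.

Definition col_start (i j : 'I_(size nu)) : nat :=
  (sumn (take j nu) + \sum_(s < size nu | i < s) deg (a s j))%N.

Definition vblock (i j : 'I_(size nu)) (r c : nat) : F :=
  if (row_start i j <= r < row_start i j + deg (a i j))%N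
     && (col_start i j <= c < col_start i j + deg (a i j))%N
  then vpoly (a i j) (r - row_start i j) (c - col_start i j) else 0.

Definition vmx (m : nat) : 'M[F]_m.-1.+1 :=
  \matrix_(r, c) \sum_i \sum_j vblock i j r c.

(* [vmx m] is invertible when [inM a] holds, see [vGLE]; the default is not used. *)
Definition vGL (m : nat) : {'GL_m[F]} := insubd (1%g : {'GL_m[F]}) (vmx m).

End Blocks.

Lemma zip_behead_cover (x : nat) (s : seq nat) r :
  path ltn x s -> (x <= r < last x s)%N ->
  exists b : nat * nat,
    [/\ b.1 \in x :: s, (b.1 <= r < b.2)%N, (b.2 <= last x s)%N &
     forall G : nat * nat -> F, \sum_(b' <- zip (x :: s) s)
       (if (b'.1 <= r < b'.2)%N then G b' else 0) = G b].
Proof.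
elim: s x => [|y s IHs] x; first by rewrite /= ltnNge andbN.
rewrite [path _ _ _]/= [last _ _]/= => /andP[xy ps] /andP[xr rl].
have yl : (y <= last y s)%N.
  elim: (s) (y) ps => //= z t IH w /andP[wz /IH]; exact/leq_trans/ltnW.
have [ry|yr] := ltnP r y.
  exists (x, y); split; rewrite ?mem_head ?xr ?ry //= => G.
  rewrite big_cons /= xr ry.
  have -> : \sum_(b' <- zip (y :: s) s)
      (if (b'.1 <= r < b'.2)%N then G b' else 0) = 0; last exact: addr0.
  elim: s y {IHs rl yl xy} ps ry => [|z t IH] y /=; first by rewrite big_nil.
  move=> /andP[yz pt] ry; rewrite big_cons /= [(y <= r)%N]leqNgt ry add0r IH //.
  exact: ltn_trans ry yz.
have [b [bs rb bl bG]] := IHs y ps (introT andP (conj yr rl)).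
exists b; split => // [|G]; first by rewrite in_cons bs orbT.
by rewrite big_cons bG /= [(r < y)%N]ltnNge yr andbF add0r.
Qed.

Lemma sorted_expts f : sorted ltn (expts f).
Proof.
by apply: sorted_filter (iota_ltn_sorted _ _); apply: ltn_trans.
Qed.

Lemma exptsE f : f != 0 -> f.[0] != 0 ->
  exists s, [/\ expts f = 0%N :: s, path ltn 0 s & last 0%N s = deg f].
Proof.
rewrite horner_coef0 => nz_f f0; have sf : (0 < size f)%N by rewrite size_poly_gt0.
have := sorted_expts f; rewrite /expts.
case E : [seq _ <- _ | _] => [|x s].
  have : 0%N \in [seq i <- iota 0 (size f) | f`_i != 0].
    by rewrite mem_filter mem_iota f0 /= sf.
  by rewrite E.
have x0 : x = 0%N.
  by move: E; rewrite -(prednK sf) /= f0 => -[].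
rewrite x0 /= => ps; exists s; split => //.
have : last 0%N [seq i <- iota 0 (size f) | f`_i != 0] = deg f.
  rewrite -{1}(prednK sf) -addn1 iotaD filter_cat last_cat /=.
  by rewrite add0n -lead_coefE lead_coef_eq0 nz_f.
by rewrite E /= x0.
Qed.

Lemma expts_nz f i : i \in expts f -> f`_i != 0.
Proof. by rewrite mem_filter => /andP[]. Qed.

Lemma antidiag_sumC f r c : antidiag_sum f r c = antidiag_sum f c r.
Proof. by apply: eq_bigr => b _; rewrite andbCA addnC. Qed.

Lemma antidiag_sumP f r : f != 0 -> f.[0] != 0 -> (r < deg f)%N ->
  exists c0 t, [/\ (c0 < deg f)%N, t != 0 &
    forall c, antidiag_sum f r c = if c == c0 then t else 0].
Proof.
move=> nz_f f0 rf; have [s [Es ps ls]] := exptsE nz_f f0.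
have [|b [bs /andP[b1r rb2] bl bG]] := @zip_behead_cover 0 s r ps.
  by rewrite ls.
exists (b.1 + (b.2 - b.1).-1 - (r - b.1))%N, f`_b.1; split.
- by rewrite -ls; apply: leq_trans bl; lia.
- by apply: expts_nz; rewrite Es.
move=> c; rewrite /antidiag_sum Es /=.
pose G (b' : nat * nat) := if (b'.1 <= c < b'.2)%N
  && ((r - b'.1) + (c - b'.1) == (b'.2 - b'.1).-1)%N then f`_b'.1 else 0.
rewrite (eq_bigr (fun b' => if (b'.1 <= r < b'.2)%N then G b' else 0)).
  rewrite bG /G; congr (if _ then _ else _); lia.
by move=> b' _; rewrite /G; case: (b'.1 <= r < b'.2)%N.
Qed.

Lemma vpolyP f r : f != 0 -> f.[0] != 0 -> (r < deg f)%N ->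
  exists c0 t, [/\ (c0 < deg f)%N, t != 0 &
    forall c, vpoly f r c = if c == c0 then t else 0].
Proof. by move=> nz_f f0 rf; apply: antidiag_sumP => //; lia. Qed.

Lemma vpoly_inj f r1 r2 c : f != 0 -> f.[0] != 0 -> (c < deg f)%N ->
  (r1 < deg f)%N -> (r2 < deg f)%N ->
  vpoly f r1 c != 0 -> vpoly f r2 c != 0 -> r1 = r2.
Proof.
move=> nz_f f0 cf rf1 rf2; rewrite /vpoly !(antidiag_sumC _ _ c).
have [r0 [t [r0f nzt E]]] := antidiag_sumP nz_f f0 cf; rewrite !E.
by case: (_ =P r0) => [?|_] nz1; case: (_ =P r0) => [?|_] nz2;
  rewrite ?eqxx // in nz1 nz2; lia.
Qed.

Section Invertible.
Variables (nu : seq nat) (a : 'M[{poly F}]_(size nu)).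
Hypothesis aM : inM a.

Let sum_take i i' : (i < i')%N ->
  (sumn (take i nu) + nth 0 nu i <= sumn (take i' nu))%N.
Proof.
move=> ii'; have [ni|ni] := ltnP i (size nu); last first.
  by rewrite nth_default // addn0 !take_oversize // (leq_trans ni) // ltnW.
rewrite -sumn_rcons -take_nth // -(subnKC ii') takeD sumn_cat leq_addr //.
Qed.

Let sumS (d : 'I_(size nu) -> nat) (P : pred 'I_(size nu)) l : P l ->
    (forall s : 'I_(size nu), (l < s)%N -> P s) ->
  (\sum_(s < size nu | l < s) d s + d l <= \sum_(s | P s) d s)%N.
Proof.
move=> Pl PS; rewrite addnC [leqRHS](bigD1 l) //= leq_add2l.
rewrite big_mkcond [leqRHS]big_mkcond /=; apply: leq_sum => s _.
by case: ifP => // ls; rewrite PS //= -val_eqE gtn_eqF.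
Qed.

Let starts_end (d : 'I_(size nu) -> 'I_(size nu) -> nat)
    (st := fun i j : 'I_(size nu) =>
      (sumn (take i nu) + \sum_(s < size nu | j < s) d i s)%N) i j :
  (forall i, \sum_j d i j = nth 0 nu i)%N -> (st i j + d i j <= sumn nu)%N.
Proof.
move=> dsum; rewrite -[nu in leqRHS](cat_take_drop i) sumn_cat.
rewrite /st -addnA leq_add2l (drop_nth 0%N) //= -dsum.
by apply: leq_trans (leq_addr _ _); apply: sumS.
Qed.

Let starts_disj (d : 'I_(size nu) -> 'I_(size nu) -> nat)
    (st := fun i j : 'I_(size nu) =>
      (sumn (take i nu) + \sum_(s < size nu | j < s) d i s)%N) i j i' j' r :
  (forall i, \sum_j d i j = nth 0 nu i)%N ->
  (st i j <= r < st i j + d i j)%N -> (st i' j' <= r < st i' j' + d i' j')%N ->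
  i = i' /\ j = j'.
Proof.
move=> dsum.
have stS k l : (st k l + d k l <= sumn (take k nu) + nth 0 nu k)%N.
  by rewrite -addnA leq_add2l -dsum sumS.
have lti (k l k' l' : 'I_(size nu)) : (k < k')%N -> (st k l + d k l <= st k' l')%N.
  move=> kk'; apply: leq_trans (stS k l) _; apply: leq_trans (sum_take kk') _.
  exact: leq_addr.
have ltj (k l l' : 'I_(size nu)) : (l' < l)%N -> (st k l + d k l <= st k l')%N.
  by move=> ll'; rewrite -addnA leq_add2l sumS // => s; apply: ltn_trans.
move=> /andP[h1 h2] /andP[h3 h4].
have ii' : i = i'.
  apply/val_inj; case: (ltngtP i i') => // /lti H; first by have := H j j'; lia.
  by have := H j' j; lia.
rewrite -{}ii' in h3 h4 *; split => //.
by apply/val_inj; case: (ltngtP j j') => // /ltj H; have := H i; lia.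
Qed.

Let starts_cover (d : 'I_(size nu) -> 'I_(size nu) -> nat)
    (st := fun i j : 'I_(size nu) =>
      (sumn (take i nu) + \sum_(s < size nu | j < s) d i s)%N) r :
  (forall i, \sum_j d i j = nth 0 nu i)%N -> (r < sumn nu)%N ->
  exists i j, (st i j <= r < st i j + d i j)%N.
Proof.
move=> dsum rm; pose i := Ordinal (reshape_indexP rm).
have : (r - sumn (take i nu) < nth 0 nu i)%N := reshape_offsetP rm.
have ri : (sumn (take i nu) <= r)%N.
  by rewrite -[leqRHS](reshape_indexK nu) /flatten_index leq_addr.
move: (r - _)%N (subnKC ri) => x def_r; clearbody i; rewrite -(dsum i) => xi; exists i.
pose Q k := (\sum_(s < size nu | k < s) d i s <= x)%N.
have exQ : exists k, Q k.
  exists (size nu); rewrite /Q big_pred0 // => s.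
  by apply/negbTE; rewrite -leqNgt ltnW.
have [k Qk kmin] := ex_minnP exQ.
have Qi : exists k, Q k /\ (x < \sum_(s < size nu | k <= s) d i s)%N.
  exists k; split => //; case: k {Qk} kmin => [|k] kmin; first exact: xi.
  by rewrite ltnNge; apply/negP=> /kmin; rewrite ltnn.
move: Qi => [l [Ql xl]].
have ln : (l < size nu)%N.
  rewrite ltnNge; apply: contraL xl => nl; rewrite -leqNgt big_pred0 // => s.
  by apply/negbTE; rewrite -ltnNge (leq_trans (ltn_ord s)).
exists (Ordinal ln); rewrite /st -def_r leq_add2l -addnA ltn_add2l.
apply/andP; split; first exact: Ql.
apply: leq_trans xl _; rewrite (bigD1 (Ordinal ln)) //= addnC leq_add2r.
rewrite big_mkcond [leqRHS]big_mkcond /=; apply: leq_sum => s _.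
by rewrite -val_eqE /= [(l < s)%N]ltn_neqAle andbC eq_sym.
Qed.

Hypothesis nu_pos : (0 < sumn nu)%N.
Let m := sumn nu.

Let vent r c := \sum_i \sum_j vblock a i j r c.

Let aij i j : a i j != 0 /\ (a i j).[0] != 0.
Proof. by have [am a0 _ _] := aM; rewrite monic_neq0. Qed.

Let ventE i j r c : (row_start a i j <= r < row_start a i j + deg (a i j))%N ->
  vent r c = vblock a i j r c.
Proof.
have [_ _ dr _] := aM => rij.
rewrite /vent (bigD1 i) //= (bigD1 j) //= !big1 ?addr0 // => k kP; last first.
  rewrite /vblock; case: ifP => // /andP[rk _].
  by have [_ jk] := starts_disj dr rij rk; rewrite jk eqxx in kP.
rewrite big1 // => l _; rewrite /vblock; case: ifP => // /andP[rk _].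
by have [ik _] := starts_disj dr rij rk; rewrite ik eqxx in kP.
Qed.

Let vent_row r : (r < m)%N -> exists c0 t, [/\ (c0 < m)%N, t != 0 &
  forall c, vent r c = if c == c0 then t else 0].
Proof.
move=> rm; have [_ _ dr dc] := aM.
have [i [j rij]] := starts_cover dr rm.
have [nza a0] := aij i j.
have [|c0 [t [c0d nzt E]]] := @vpolyP (a i j) (r - row_start a i j) nza a0.
  by move: rij => /andP[]; rewrite /row_start; lia.
exists (col_start a i j + c0)%N, t; split => // [|c].
  have := @starts_end (fun x y => deg (a y x)) j i dc.
  by rewrite /col_start -/m; lia.
rewrite (ventE _ rij) /vblock rij /=; case: ifP => [cij|ncij].
  rewrite E; congr (if _ then _ else _); lia.
case: eqP ncij => // ->; lia.
Qed.

Let vent_inj r1 r2 c : (r1 < m)%N -> (r2 < m)%N ->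
  vent r1 c != 0 -> vent r2 c != 0 -> r1 = r2.
Proof.
move=> r1m r2m; have [_ _ dr dc] := aM.
have [i [j rij]] := starts_cover dr r1m.
have [k [l rkl]] := starts_cover dr r2m.
rewrite (ventE _ rij) (ventE _ rkl) /vblock.
case: ifP => [/andP[_ cij] v1|_]; last by rewrite eqxx.
case: ifP => [/andP[_ ckl] v2|_]; last by rewrite eqxx.
have [ji lk] := @starts_disj (fun x y => deg (a y x)) _ _ _ _ _ dc cij ckl.
subst k l.
have [nza a0] := aij i j.
have := vpoly_inj nza a0 _ _ _ v1 v2.
move: rij rkl cij; rewrite /row_start /col_start; lia.
Qed.

Fact vmx_unit : vmx a (sumn nu) \in unitmx.
Proof.
have m1 : m.-1.+1 = m by rewrite prednK.
have rowP (r : 'I_m.-1.+1) : {ct : 'I_m.-1.+1 * F | ct.2 != 0 /\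
    forall c : 'I_m.-1.+1, vmx a m r c = if c == ct.1 then ct.2 else 0}.
  apply: cid; have [|c0 [t [c0m nzt E]]] := @vent_row r.
    by rewrite -[ltnRHS]m1.
  rewrite -[ltnRHS]m1 in c0m; exists (Ordinal c0m, t); split=> // c.
  by rewrite mxE; apply: E.
pose sg r := (sval (rowP r)).1; pose kk r := (sval (rowP r)).2.
have sg_inj : injective sg.
  move=> r1 r2 e; apply/val_inj; apply: (@vent_inj _ _ (sg r1)).
  - by apply: leq_trans (ltn_ord _) _; rewrite m1.
  - by apply: leq_trans (ltn_ord _) _; rewrite m1.
  - have [nz /(_ (sg r1))] := svalP (rowP r1); rewrite mxE => E.
    by rewrite /vent E eqxx.
  have [nz /(_ (sg r1))] := svalP (rowP r2); rewrite mxE => E.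
  by rewrite /vent E e eqxx.
have -> : vmx a m = diag_mx (\row_r kk r) *m perm_mx (perm sg_inj).
  apply/matrixP=> r c; rewrite mul_diag_mx !mxE permE.
  have [_ /(_ c)] := svalP (rowP r); rewrite mxE => ->.
  by rewrite eq_sym -/(sg r) -/(kk r); case: eqP; rewrite ?mulr1 ?mulr0.
rewrite unitmx_mul unitmx_perm andbT unitmxE det_diag unitfE.
by apply/prodf_neq0 => r _; rewrite mxE; have [] := svalP (rowP r).
Qed.

End Invertible.

Lemma vGLE (m : nat) (nu : seq nat) (a : 'M[{poly F}]_(size nu)) :
  (0 < m)%N -> is_composition m nu -> inM a -> GLval (vGL a m) = vmx a m.
Proof.
move=> m_gt0 /andP[_ /eqP def_m] aM; rewrite /vGL [LHS]insubdK //.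
by rewrite -def_m in m_gt0 *; exact: vmx_unit.
Qed.

Definition diag_poly (mu : seq nat) (f : 'I_(size mu) -> {poly F}) :
  'M[{poly F}]_(size mu) := \matrix_(i, j) (if i == j then f i else 1).

Lemma diag_poly_inM (mu : seq nat) (f : 'I_(size mu) -> {poly F}) :
  (forall i : 'I_(size mu), inM (nu := [:: nth 0%N mu i]) (const_mx (f i))) ->
  inM (diag_poly f).
Proof.
move=> fM.
have fP i : [/\ f i \is monic, (f i).[0] != 0 & deg (f i) = nth 0%N mu i].
  have [/(_ 0 0) + /(_ 0 0) + /(_ 0) + _] := fM i.
  by rewrite big_ord1 !mxE.
have d0 i j : j != i -> deg (diag_poly f i j) = 0%N.
  by move=> /negPf ji; rewrite mxE eq_sym ji /deg size_poly1.
split=> [i j|i j|i|j].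
- by rewrite mxE; case: (i =P j) => _; [case: (fP i)|apply: monic1].
- by rewrite mxE; case: (i =P j) => _; [case: (fP i)|rewrite hornerE oner_eq0].
- rewrite (bigD1 i) //= big1 => [|j /d0 //]; rewrite addn0 mxE eqxx.
  by case: (fP i).
rewrite (bigD1 j) //= big1 => [|i ij]; last by rewrite d0 // eq_sym.
by rewrite addn0 mxE eqxx; case: (fP j).
Qed.

(* [reshape_index mu r] is the index of the block of [mu] containing [r]. *)
Definition parabolic (n : nat) (mu : seq nat) : {set {'GL_n[F]}} :=
  [set g : {'GL_n[F]} | [forall r : 'I_n.-1.+1, forall c : 'I_n.-1.+1,
    (reshape_index mu c < reshape_index mu r)%N ==> (g r c == 0)]].

Definition levi (n : nat) (mu : seq nat) : {set {'GL_n[F]}} :=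
  [set g : {'GL_n[F]} | [forall r : 'I_n.-1.+1, forall c : 'I_n.-1.+1,
    (reshape_index mu c != reshape_index mu r) ==> (g r c == 0)]].

End MonomialMatrices.

Definition heckeT (F : finFieldType) (C : numFieldType) (psi : addchar F C)
    (m : nat) (nu : seq nat) (a : 'M[{poly F}]_(size nu)) : heckeA psi m nu :=
  heckeElt psi nu (vGL a m).

(* Main.v *)
Require Import Defs.
From mathcomp Require Import all_boot all_order all_algebra all_fingroup all_field.
From mathcomp Require Import complex reals.
From mathcomp Require Import boolp zify.

(* Let N be the unipotent radical of P_mu and rho the average of N. Since psi_mu
   is trivial on N, rho absorbs e_mu; and e_mu = (e_(mu_1) (+) .. (+) e_(mu_l)) rho,
   because the right-hand side is a psi_mu-eigenvector of every u in U_n, the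
   unitriangular group being the product of its block diagonal part and of N.
   As L_mu normalizes N, rho commutes with the group algebra of L_mu, so that
   x_1 (x) .. (x) x_l |-> (x_1 (+) .. (+) x_l) rho is multiplicative on the Hecke
   algebras and equals e_mu (x_1 (+) .. (+) x_l) e_mu. Its coefficient at the block
   diagonal element g is prod_i x_i(g_i) / |N|, whence injectivity.
   Uniqueness requires that the T_(f) span H_(m). By the Bruhat decomposition
   H_(m) is spanned by the e n e, n monomial, and e n e = 0 unless n intertwines
   the character with itself; this forces every ascent of the permutation of n to
   be by one, with equal coefficients, so that n consists of scalar blocks placed
   along the antidiagonal, i.e. n = v_(f). *)

Set Implicit Arguments.
Unset Strict Implicit.
Unset Printing Implicit Defensive.
Import Order.TTheory GRing.Theory Num.Theory.
Local Open Scope ring_scope.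

(** * Antidiagonal blocks and polynomials *)

Section AntidiagonalBlocks.
Variable F : finFieldType.
Implicit Types f : {poly F}.

Lemma mem_zipl (S T : eqType) (s : seq S) (t : seq T) p :
  p \in zip s t -> p.1 \in s.
Proof.
elim: s t => [|x s IHs] [|y t] //=; rewrite !inE => /predU1P[->|/IHs ->].
  by rewrite eqxx.
by rewrite orbT.
Qed.

(** That no element of the sequence lies strictly inside the chosen interval determines this
    interval from [r] alone, independently of [G]. *)
Lemma zip_behead_block (V : nmodType) (x : nat) (s : seq nat) r
    (G : nat * nat -> V) :
  path ltn x s -> (x <= r < last x s)%N ->
  exists b : nat * nat,
    [/\ b.1 \in x :: s, b.2 \in s, (b.1 <= r < b.2)%N,
        forall y, y \in x :: s -> (y <= b.1)%N || (b.2 <= y)%N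
      & \sum_(b' <- zip (x :: s) s)
          (if (b'.1 <= r < b'.2)%N then G b' else 0) = G b].
Proof.
elim: s x => [|y s IHs] x; first by rewrite /= ltnNge andbN.
rewrite [path _ _ _]/= [last _ _]/= => /andP[xy ps] /andP[xr rl].
have ys z : z \in s -> (y < z)%N.
  by move: ps => /(order_path_min ltn_trans)/allP; apply.
have [ry|yr] := ltnP r y.
  exists (x, y); split; rewrite ?mem_head ?xr ?ry //=.
    by move=> z; rewrite !inE => /or3P[/eqP->|/eqP->|/ys]; lia.
  rewrite big_cons /= xr ry big_seq big1 ?addr0 // => -[b1 b2] /mem_zipl /=.
  rewrite inE; case: ifP => // /andP[b1r _] /orP[/eqP b1y|/ys]; lia.
have [b [b1s b2s rb bmin bG]] := IHs y ps (introT andP (conj yr rl)).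
exists b; split => //.
- by rewrite in_cons b1s orbT.
- by rewrite in_cons b2s orbT.
- move=> z; rewrite in_cons => /predU1P[->|/bmin //].
  by apply/orP; left; move: b1s; rewrite inE => /predU1P[->|/ys]; lia.
by rewrite big_cons bG /= [(r < y)%N]ltnNge yr andbF add0r.
Qed.

Lemma mem_expts f i : (i \in expts f) = (f`_i != 0).
Proof.
rewrite mem_filter mem_iota add0n /=; case: ltnP => [_|si]; first by rewrite andbT.
by rewrite nth_default // eqxx.
Qed.

Lemma antidiag_sumE f r : f.[0] != 0 -> (r < deg f)%N ->
  exists b1 b2, [/\ (b1 <= r < b2)%N, f`_b1 != 0, f`_b2 != 0,
    (forall i, (b1 < i < b2)%N -> f`_i = 0)
   & forall c, antidiag_sum f r c = f`_b1 *+ (c == b1 + b2.-1 - r)%N].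
Proof.
move=> f0 rf; have nzf : f != 0 by apply: contraNneq f0 => ->; rewrite horner0.
have [s [Es ps ls]] := exptsE nzf f0.
pose G c (b' : nat * nat) := if (b'.1 <= c < b'.2)%N
  && ((r - b'.1) + (c - b'.1) == (b'.2 - b'.1).-1)%N then f`_b'.1 else 0.
have GE c : antidiag_sum f r c = \sum_(b' <- zip (0%N :: s) s)
    (if (b'.1 <= r < b'.2)%N then G c b' else 0).
  by rewrite /antidiag_sum Es; apply: eq_bigr => b _; case: (_ <= r < _)%N.
have r0 : (0 <= r < last 0 s)%N by rewrite ls.
have [b [b1s b2s rb bmin _]] := zip_behead_block (G 0%N) ps r0.
exists b.1, b.2; split=> //.
- by rewrite -mem_expts Es.
- by rewrite -mem_expts Es inE b2s orbT.
- move=> i ib; apply: contraTeq ib; rewrite -mem_expts Es => /bmin; lia.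
(* The summand depends on the column, so each column gets its own interval [d]. Both [b] and [d]
   contain [r] and have no exponent strictly inside, hence they agree. *)
move=> c; have [d [d1s d2s rd dmin]] := zip_behead_block (G c) ps r0.
rewrite GE => ->.
have b2s' : b.2 \in 0%N :: s by rewrite inE b2s orbT.
have d2s' : d.2 \in 0%N :: s by rewrite inE d2s orbT.
have [] := (bmin _ d1s, bmin _ d2s', dmin _ b1s, dmin _ b2s') => -[[h1 h2] h3] h4.
have -> : d = b by rewrite [d]surjective_pairing [b]surjective_pairing; congr pair; lia.
by rewrite /G mulrb; congr (if _ then _ else _); lia.
Qed.

End AntidiagonalBlocks.

Lemma card_ord_lt m v : (v <= m)%N -> #|[set x : 'I_m | (x < v)%N]| = v.
Proof.
move=> vm; rewrite cardsE -sum1_card.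
by rewrite (big_ord_narrow vm) sum1_card card_ord.
Qed.

(* When every descent of [tau] is by exactly one, [tau] is the direct sum of
   the decreasing permutations of the intervals between consecutive [starts]. *)
Section Runs.
Variables (m : nat) (tau : nat -> nat).
Hypotheses (tau_lt : forall r, (r < m)%N -> (tau r < m)%N)
  (tau_inj : forall r r', (r < m)%N -> (r' < m)%N -> tau r = tau r' -> r = r')
  (tau_desc : forall r, (r.+1 < m)%N -> (tau r.+1 < tau r)%N ->
     tau r = (tau r.+1).+1).

(** Start of a maximal decreasing run. These indices become the exponents below [m] of the
    polynomial built in [runs_antidiag_sum]. *)
Definition run_start r := (r == 0)%N || (tau r.-1 < tau r)%N.

(** Induction on the distance. A run takes consecutive values, so by injectivity an ascent out of it
    must jump above its first value; and a descent by one from above [tau r] cannot pass below it,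
    since [tau r] is taken. *)
Lemma run_cmp r d : (r + d.+1 < m)%N ->
  (tau r < tau (r + d.+1))%N \/
  (tau r = tau (r + d.+1) + d.+1)%N /\
  (forall k, (r < k <= r + d.+1)%N -> ~~ run_start k).
Proof.
elim: d => [|d IHd] rm.
  have := tau_desc (r := r); have := @tau_inj r r.+1; rewrite addn1 in rm *.
  case: (ltngtP (tau r) (tau r.+1)) => lt_tau; [by left | | by lia].
  move=> _ /(_ rm isT) ->; right; split=> [|k kr]; first lia.
  have -> : k = r.+1 by lia.
  by rewrite /run_start /=; lia.
move: IHd; have [r1 r1E] : {r1 | r1 = (r + d.+1)%N} by exists (r + d.+1)%N.
rewrite -r1E => IHd; have r1m : (r1.+1 < m)%N by lia.
have -> : (r + d.+2)%N = r1.+1 by lia.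
have [lt|[eq nos]] := IHd (ltnW r1m).
  left; case: (ltngtP (tau r1) (tau r1.+1)) => lt1.
  - exact: ltn_trans lt1.
  - have := tau_desc r1m lt1; have := @tau_inj r r1.+1.
    by lia.
  - by have := @tau_inj r1 r1.+1; lia.
case: (ltngtP (tau r1) (tau r1.+1)) => lt1.
- left; rewrite ltnNge; apply/negP=> le1.
  (* otherwise [tau r1.+1] is already taken by an index of the run of [r] *)
  pose k := (tau r - tau r1.+1)%N.
  have kd : (k < d.+1)%N by rewrite /k; lia.
  have [k0|kpos] := posnP k.
    by have := @tau_inj r r1.+1; lia.
  have rk : (r + k < r1)%N by lia.
  suff eqk : tau (r + k)%N = tau r1.+1 by have := tau_inj _ _ eqk; lia.
  suff nos_eq j : (j <= d.+1)%N -> tau r = (tau (r + j) + j)%N.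
    by have := nos_eq k; rewrite /k; lia.
  elim: j => [|j IHj] jd; first by rewrite !addn0.
  have rj : (r < (r + j).+1 <= r1)%N by lia.
  have := nos _ rj; rewrite /run_start /= -leqNgt; have := IHj (ltnW jd).
  have := @tau_desc (r + j); have := @tau_inj (r + j) (r + j).+1.
  by rewrite [(r + j.+1)%N]addnS; lia.
- right; have := tau_desc r1m lt1; split; first lia.
  move=> k kr; have [kr1|] := leqP k r1; first by apply: nos; lia.
  move=> kr1; have -> : k = r1.+1 by lia.
  by rewrite /run_start /=; lia.
by have := @tau_inj r1 r1.+1; lia.
Qed.

(** Values drop by one along the run, so only [tau b1] has to be found, by counting the indices of
    smaller value. *)
Lemma run_value b1 b2 r : (b1 <= r < b2)%N -> (b2 <= m)%N ->
  run_start b1 -> (b2 < m -> run_start b2)%N ->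
  (forall k, (b1 < k < b2)%N -> ~~ run_start k) ->
  tau r = (b1 + b2.-1 - r)%N.
Proof.
move=> rb b2m sb1 sb2 nos.
have lt_start b i j : run_start b -> (i < b <= j)%N -> (j < m)%N ->
    (tau i < tau j)%N.
  move=> sb ibj jm; have jE : j = (i + (j - i).-1.+1)%N by lia.
  have [||[_ /(_ b)]] := @run_cmp i (j - i).-1; rewrite -?jE //.
  by rewrite sb => /(_ ibj).
have desc k : (b1 + k < b2)%N -> tau b1 = (tau (b1 + k) + k)%N.
  elim: k => [|k IHk] kb; first by rewrite !addn0.
  rewrite [(b1 + k.+1)%N]addnS in kb *; have bk : (b1 < (b1 + k).+1 < b2)%N by lia.
  have := nos _ bk; rewrite /run_start /= -leqNgt; have := IHk (ltnW kb).
  have := @tau_desc (b1 + k); have := @tau_inj (b1 + k) (b1 + k).+1.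
  lia.
pose p (i : 'I_m) := Ordinal (tau_lt (ltn_ord i)).
have p_inj : injective p.
  by move=> i j /(congr1 val) /= /tau_inj ij; apply/val_inj/ij; apply: ltn_ord.
have b1m : (b1 < m)%N by lia.
have b1v : tau b1 = b2.-1.
  have tb1 := tau_lt b1m.
  (* As [p] permutes the indices, [tau b1] is the number of indices of smaller value: these are the
     indices below [b2] other than [b1]. *)
  rewrite -(card_ord_lt (ltnW tb1)).
  have -> : #|[set x : 'I_m | (x < tau b1)%N]|
      = #|p @^-1: [set x : 'I_m | (x < tau b1)%N]|.
    by rewrite on_card_preimset //; apply: onW_bij; apply: injF_bij.
  have -> : p @^-1: [set x : 'I_m | (x < tau b1)%N]
      = [set x : 'I_m | (x < b2)%N] :\ Ordinal b1m.
    apply/setP=> i; rewrite !inE -val_eqE /=.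
    have im := ltn_ord i; have [ib1|b1i|->] := ltngtP i b1; last by rewrite ltnn.
    - by rewrite (lt_start b1) ?ib1 //=; lia.
    - have [ib2|b2i] := ltnP i b2.
        by have := desc (i - b1)%N; rewrite subnKC; lia.
      apply/negbTE; rewrite -leqNgt ltnW // (lt_start b2) //; last by lia.
      by apply: sb2; lia.
  have := cardsD1 (Ordinal b1m) [set x : 'I_m | (x < b2)%N].
  by rewrite card_ord_lt // inE /=; lia.
by have := desc (r - b1)%N; rewrite subnKC; lia.
Qed.

End Runs.

Lemma runs_antidiag_sum (F : finFieldType) m (tau : nat -> nat) (a : nat -> F) :
  (0 < m)%N ->
  (forall r, (r < m)%N -> (tau r < m)%N) ->
  (forall r r', (r < m)%N -> (r' < m)%N -> tau r = tau r' -> r = r') ->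
  (forall r, (r < m)%N -> a r != 0) ->
  (forall r, (r.+1 < m)%N -> (tau r.+1 < tau r)%N ->
     tau r = (tau r.+1).+1 /\ a r = a r.+1) ->
  exists f : {poly F}, [/\ f \is monic, f.[0] != 0, deg f = m &
    forall r c, (r < m)%N -> antidiag_sum f r c = a r *+ (c == tau r)].
Proof.
move=> m_gt0 tau_lt tau_inj a_neq0 tau_desc.
(* The coefficients at the run starts make the consecutive exponents of [f] bound the runs; the one
   at [m] makes [f] monic. *)
pose co i : F := if i == m then 1 else if run_start tau i then a i else 0.
pose f := \poly_(i < m.+1) co i.
have com : co m != 0 by rewrite /co eqxx oner_eq0.
have sf : size f = m.+1 by apply: size_poly_eq.
have f0 : f.[0] != 0.
  by rewrite horner_coef0 coef_poly /co /run_start /= ltn_eqF // a_neq0.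
have fE i : (i < m)%N -> f`_i = if run_start tau i then a i else 0.
  by move=> im; rewrite coef_poly ltnS ltnW // /co ltn_eqF.
have df : deg f = m by rewrite /deg sf.
exists f; split=> // [|r c rm].
  by rewrite monicE lead_coefE sf coef_poly ltnSn /co eqxx.
have [|b1 [b2 [rb fb1 fb2 fb ->]]] := @antidiag_sumE _ f r f0; first by rewrite df.
have b2m : (b2 <= m)%N.
  by rewrite leqNgt; apply: contraNN fb2 => mb2; rewrite nth_default // sf.
have b1m : (b1 < m)%N by lia.
have sb1 : run_start tau b1.
  by move: fb1; rewrite fE //; case: ifP => //; rewrite eqxx.
have sb2 : (b2 < m -> run_start tau b2)%N.
  by move=> b2m'; move: fb2; rewrite fE //; case: ifP => //; rewrite eqxx.
have nos k : (b1 < k < b2)%N -> ~~ run_start tau k.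
  move=> kb; have km : (k < m)%N by lia.
  by have /eqP := fb _ kb; rewrite fE //; case: ifP => // _; rewrite (negPf (a_neq0 _ km)).
rewrite -(@run_value m tau _ _ _ b1 b2) //; last by move=> k km kt; have [] := tau_desc k km kt.
rewrite fE // sb1; congr (_ *+ _).
(* It remains to see that [a] is constant along the run from [b1] to [r]. *)
have : (b1 <= r)%N by lia.
elim: r rb {rm} => [|r IHr] rb b1r; first by have -> : b1 = 0%N by lia.
have [->//|nb1] := eqVneq b1 r.+1.
rewrite IHr; [|lia|lia].
have rb' : (b1 < r.+1 < b2)%N by lia.
have := nos _ rb'; rewrite /run_start /= -leqNgt leq_eqVlt => /predU1P[eq_tau|lt_tau].
  by have := tau_inj r r.+1; lia.
have rm' : (r.+1 < m)%N by lia.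
by have [] := tau_desc r rm' lt_tau.
Qed.

(** * Matrices attached to a single polynomial *)

Lemma GL_inj (F : finFieldType) m (g h : {'GL_m[F]}) :
  GLval g =2 GLval h -> g = h.
Proof. by move=> gh; apply/val_inj/matrixP. Qed.

Lemma inM_polyP (F : finFieldType) m (f : {poly F}) :
  inM (nu := [:: m]) (const_mx f) <->
  [/\ f \is monic, f.[0] != 0 & deg f = m].
Proof.
split=> [[fmon f0 fd _]|[fmon f0 fd]].
  by have := (fmon 0 0, f0 0 0, fd 0); rewrite big_ord1 !mxE => -[[-> ->] ->].
by split=> [i j|i j|i|j]; rewrite ?big_ord1 !mxE // ord1.
Qed.

Lemma vmx_poly (F : finFieldType) m (f : {poly F}) (r c : 'I_m.-1.+1) :
  (0 < m)%N -> deg f = m ->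
  vmx (nu := [:: m]) (const_mx f) m r c = vpoly f r c.
Proof.
move=> m_gt0 df; rewrite mxE !big_ord1 /vblock /row_start /col_start !mxE /=.
rewrite !big1 ?addn0 ?add0n ?subn0; try by move=> s; rewrite ord1 ltnn.
have lt_m (i : 'I_m.-1.+1) : (i < m)%N by rewrite -[ltnRHS](prednK m_gt0).
by rewrite df !lt_m.
Qed.

Lemma is_composition1 m : (0 < m)%N -> is_composition m [:: m].
Proof. by move=> m_gt0; rewrite /is_composition /= m_gt0 addn0 eqxx. Qed.

(** * Bruhat decomposition *)

Section Bruhat.
Variables (F : finFieldType) (m : nat).
Local Notation GL := {'GL_m[F]}.
Local Notation U := (unitri F m).
Local Notation I := 'I_m.-1.+1.

Lemma unitri_matrix (M : 'M[F]_m.-1.+1) :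
  (forall i j : I, (j <= i)%N -> M i j = (i == j)%:R) ->
  exists2 u : GL, u \in U & GLval u = M.
Proof.
move=> MU; have Munit : M \in unitmx.
  rewrite unitmxE -det_tr det_trig ?big1 ?unitr1 // => [i _|].
    by rewrite mxE MU // eqxx.
  by apply/is_trig_mxP => i j ij; rewrite mxE MU 1?ltnW // -val_eqE gtn_eqF.
exists (insubd (1%g : GL) M); last exact: insubdK.
by apply/unitriP=> i j ji; rewrite [GLval _]insubdK // MU.
Qed.

(** An elementary operation: on the left it adds to row [i] a combination of later rows, on the
    right it adds multiples of column [i] to later columns. *)
Lemma unitri_row (i : I) (a : 'rV[F]_m.-1.+1) :
  (forall k : I, (k <= i)%N -> a 0 k = 0) ->
  exists2 u : GL, u \in U & GLval u = 1%:M + delta_mx i 0 *m a.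
Proof.
move=> a0; apply: unitri_matrix => k j jk; rewrite !mxE big_ord1 mxE eqxx andbT.
by case: (k =P i) jk => [-> /a0->|_ _]; rewrite ?mulr0 ?mul0r addr0.
Qed.

(** Compare the entries of [h * h^-1 = 1]. Only the rows in [P] are assumed monomial, so that this
    applies in the middle of the elimination in [bruhat_unitri]. *)
Lemma monomial_rowV (h : GL) (P : pred I) (s : I -> I) (t : I -> F) :
  (forall r c, P r -> GLval h r c = t r *+ (c == s r)) ->
  forall r k, P r -> t r * GLval h^-1 (s r) k = (r == k)%:R.
Proof.
move=> hE r k Pr.
have -> : (r == k)%:R = GLval (h * h^-1) r k by rewrite mulgV GL_1E mxE.
rewrite GL_MxE mxE (bigD1 (s r)) //= hE // eqxx big1 ?addr0 // => c /negPf cs.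
by rewrite hE // cs mul0r.
Qed.

Lemma monomial_row_neq0 (h : GL) (P : pred I) (s : I -> I) (t : I -> F) :
  (forall r c, P r -> GLval h r c = t r *+ (c == s r)) ->
  forall r, P r -> t r != 0.
Proof.
move=> hE r Pr; apply: contra_eq_neq (monomial_rowV hE r Pr) => ->.
by rewrite mul0r eqxx eq_sym oner_eq0.
Qed.

Lemma monomial_row_inj (h : GL) (P : pred I) (s : I -> I) (t : I -> F) :
  (forall r c, P r -> GLval h r c = t r *+ (c == s r)) -> {in P &, injective s}.
Proof.
move=> hE r r' Pr Pr' srr'; have [//|nrr'] := eqVneq r r'.
have /eqP := monomial_rowV hE r' Pr.
rewrite srr' (negPf nrr') mulf_eq0 (negPf (monomial_row_neq0 hE Pr)) /= => /eqP hV0.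
have := monomial_rowV hE r' Pr'; rewrite hV0 mulr0 eqxx => /eqP.
by rewrite eq_sym oner_eq0.
Qed.

Lemma row_nz (h : GL) (i : I) : exists j, GLval h i j != 0.
Proof.
apply/existsP; rewrite -negb_forall; apply/forallP=> h0.
have /eqP : GLval (h * h^-1) i i = 1 by rewrite mulgV GL_1E mxE eqxx.
rewrite GL_MxE mxE big1 => [|k _]; last by rewrite (eqP (h0 k)) mul0r.
by rewrite eq_sym oner_eq0.
Qed.

(** Gaussian elimination from the bottom row up. Rows are only added to earlier rows and columns
    only to later columns, so both factors are unitriangular. *)
Lemma bruhat_unitri (g : GL) : exists u v (s : I -> I) (t : I -> F),
  [/\ u \in U, v \in U &
    forall r c, GLval (u * g * v) r c = t r *+ (c == s r)].
Proof.
suff H d : (d <= m.-1.+1)%N -> exists u v (s : I -> I) (t : I -> F),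
    [/\ u \in U, v \in U & forall r c : I, (m.-1.+1 - d <= r)%N ->
      GLval (u * g * v) r c = t r *+ (c == s r)].
  have [u [v [s [t [uU vU ugvE]]]]] := H _ (leqnn _).
  by exists u, v, s, t; split=> // r c; apply: ugvE; rewrite subnn.
elim: d => [|d IHd] dm.
  exists 1%g, 1%g, id, (fun=> 0); split; rewrite ?group1 // => r c.
  by rewrite subn0 leqNgt ltn_ord.
have [u [v [s [t [uU vU hE]]]]] := IHd (ltnW dm).
set h := (u * g * v)%g in hE.
have iP : (m.-1.+1 - d.+1 < m.-1.+1)%N by lia.
pose i := Ordinal iP.
have idE (r : I) : (m.-1.+1 - d <= r)%N = (i < r)%N by rewrite /=; lia.
pose P := [pred r : I | (i < r)%N].
have {}hE r c : P r -> GLval h r c = t r *+ (c == s r).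
  by move=> ir; apply: hE; rewrite idE.
(* Coefficients clearing row [i] in the columns [s k] occupied by the rows below. *)
pose a := \row_(r < m.-1.+1) (if P r then - (GLval h i (s r) / t r) else 0).
have [k ki|u1 u1U u1E] := @unitri_row i a; first by rewrite mxE /= ltnNge ki.
have u1hE r c : GLval (u1 * h) r c = GLval h r c + (r == i)%:R
    * \sum_(k | P k) - (GLval h i (s k) / t k) * GLval h k c.
  rewrite GL_MxE u1E mulmxDl mul1mx -mulmxA mxE; congr (_ + _).
  rewrite mxE big_ord1 !mxE andbT; congr (_ * _).
  rewrite [RHS]big_mkcond; apply: eq_bigr => l _; rewrite !mxE.
  by case: ifP => // _; rewrite mul0r.
have h1P r c : P r -> GLval (u1 * h) r c = t r *+ (c == s r).
  move=> Pr; rewrite u1hE -hE // -val_eqE gtn_eqF // mul0r.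
  exact: addr0.
have h1i k : P k -> GLval (u1 * h) i (s k) = 0.
  move=> Pk; rewrite u1hE eqxx mul1r (bigD1 k) //= big1 => [|l /andP[Pl lk]].
    rewrite (hE k) // eqxx addr0 mulNr divfK ?subrr //.
    exact: (monomial_row_neq0 hE).
  rewrite (hE l) // eq_sym (inj_in_eq (monomial_row_inj hE)) // (negPf lk).
  exact: mulr0.
(* The leftmost nonzero entry of row [i] is its pivot; [b] clears the entries to the right of it. *)
have [j0 hj0] := row_nz (u1 * h) i.
have [j hj jmin] := @arg_minnP _ j0 (fun j => GLval (u1 * h) i j != 0) val hj0.
pose b := \row_(k < m.-1.+1)
  (if (j < k)%N then - (GLval (u1 * h) i k / GLval (u1 * h) i j) else 0).
have bE k : b 0 k = if (j < k)%N
    then - (GLval (u1 * h) i k / GLval (u1 * h) i j) else 0 by rewrite mxE.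
have [k kj|v1 v1U v1E] := @unitri_row j b; first by rewrite bE ltnNge kj.
have h2E r c : GLval (u1 * h * v1) r c =
    GLval (u1 * h) r c + GLval (u1 * h) r j * b 0 c.
  rewrite GL_MxE v1E mulmxDr mulmx1 mulmxA mxE; congr (_ + _).
  rewrite mxE big_ord1; congr (_ * _); rewrite mxE (bigD1 j) //=.
  rewrite [delta_mx _ _ _ _]mxE !eqxx mulr1 big1 ?addr0 // => l /negPf lj.
  by rewrite [delta_mx _ _ _ _]mxE lj mulr0.
exists (u1 * u)%g, (v * v1)%g, (fun r => if r == i then j else s r),
  (fun r => if r == i then GLval (u1 * h) i j else t r).
split; rewrite ?groupM // => r c ir.
have -> : (u1 * u * g * (v * v1) = u1 * h * v1)%g by rewrite /h !mulgA.
rewrite h2E; have [->|nri] := eqVneq r i.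
  have [->|ncj] := eqVneq c j; first by rewrite bE ltnn mulr0 addr0.
  rewrite bE; case: ltnP => [jc|cj].
    by rewrite mulrN mulrCA divff // mulr1 subrr.
  rewrite mulr0 addr0; apply/eqP; apply: contraNT ncj => /jmin jc.
  by rewrite -val_eqE eqn_leq cj.
have Pr : P r by move: ir nri; rewrite /= -val_eqE /=; lia.
(* The column operations leave the lower rows unchanged: the pivot column is none of their [s r],
   where row [i] has been cleared. *)
rewrite !h1P //; have [jE|_] := eqVneq j (s r); last by rewrite mul0r addr0.
by move: hj; rewrite jE h1i ?eqxx.
Qed.

End Bruhat.

(* The descents of the column index read upwards are the ascents read downwards. *)
Lemma monomial_vGL (F : finFieldType) m (g : {'GL_m[F]})
    (s : 'I_m.-1.+1 -> 'I_m.-1.+1) (t : 'I_m.-1.+1 -> F) :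
  (0 < m)%N -> (forall r c, GLval g r c = t r *+ (c == s r)) ->
  (forall r r' : 'I_m.-1.+1, r' = r.+1 :> nat -> (s r < s r')%N ->
     s r' = (s r).+1 :> nat /\ t r' = t r) ->
  exists2 f : {poly F}, inM (nu := [:: m]) (const_mx f) &
    g = vGL (nu := [:: m]) (const_mx f) m.
Proof.
move=> m_gt0 gE s_asc; have mE := prednK m_gt0.
have gE' r c : xpredT r -> GLval g r c = t r *+ (c == s r) by [].
have t_neq0 r : t r != 0 := monomial_row_neq0 gE' (r := r) isT.
have s_inj : injective s := fun r r' => monomial_row_inj gE' (x := r) (y := r') isT isT.
(* Reversal of the rows, undoing the factor [w_(m)] in [v_(f)]. *)
pose up r : 'I_m.-1.+1 := inord (m.-1 - r).
have upE r : (r < m)%N -> up r = (m.-1 - r)%N :> nat.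
  by move=> rm; rewrite inordK // mE; lia.
have [|||r|f [fmon f0 df fE]] := @runs_antidiag_sum F m
  (fun r => s (up r)) (fun r => t (up r)) m_gt0.
- by move=> r _; rewrite -[ltnRHS]mE.
- move=> r r' rm r'm /val_inj/s_inj/(congr1 val) /=; rewrite !upE //; lia.
- by move=> r _; apply: t_neq0.
- move=> rm lts; have [||-> ->] // := s_asc (up r.+1) (up r) => //.
  by rewrite !upE //; lia.
exists f; first exact/inM_polyP.
apply: GL_inj => r c; have rm : (r < m)%N by rewrite -[ltnRHS]mE.
rewrite vGLE ?is_composition1 //; last exact/inM_polyP.
rewrite vmx_poly // /vpoly df fE ?gE; last by lia.
have -> : up (m.-1 - r)%N = r by apply/val_inj; rewrite /= upE; lia.
by [].
Qed.

(** * Spanning by the elements of polynomials *)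

Lemma mulr_scale_mid (K : fieldType) (A : algType K) (a : K) (x y z : A) :
  x * (a *: y) * z = a *: (x * y * z).
Proof. by rewrite -scalerAr -scalerAl. Qed.

Lemma eigen_mul (K : fieldType) (A : algType K) (a b : K) (E x g y : A) :
  E * x = a *: E -> y * E = b *: E -> E * (x * g * y) * E = (a * b) *: (E * g * E).
Proof.
move=> Ex yE; rewrite !mulrA Ex -!scalerAl -!mulrA yE -!scalerAr scalerA.
by rewrite !mulrA.
Qed.

(** The right-hand counterpart of [gelt_eidem], by the substitution of [v * u^-1] for [v]. *)
Lemma char_sum_gelt (K : fieldType) (gT : finGroupType) (U : {group gT})
    (chi : gT -> K) (a : K) u :
  {in U &, {morph chi : v w / (v * w)%g >-> v * w}} -> u \in U ->
  (a *: \sum_(v in U) chi v^-1%g *: gelt K v) * gelt K u =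
    chi u *: (a *: \sum_(v in U) chi v^-1%g *: gelt K v).
Proof.
move=> chiM uU; rewrite -scalerAl scalerA mulrC -scalerA; congr (_ *: _).
rewrite mulr_suml scaler_sumr (reindex_inj (mulIg u^-1%g)) /=.
apply: eq_big => [v|v vU]; first by rewrite groupMr ?groupV.
rewrite -scalerAl -geltM mulgKV invMg invgK.
rewrite groupMr ?groupV // in vU.
by rewrite chiM ?groupV // scalerA.
Qed.

Section HeckeElements.
Variables (F : finFieldType) (C : numFieldType) (psi : addchar F C).
Variables (m : nat) (nu : seq nat).
Local Notation GL := {'GL_m[F]}.
Local Notation U := (unitri F m).
Local Notation e := (eidem psi m nu).

Lemma eidem_gelt u : u \in U -> e * gelt C u = psinu psi nu u *: e.
Proof. exact: (char_sum_gelt (U := unitri_group F m) _ (psinuM psi nu)). Qed.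

Lemma heckeElt_unitri u g v : u \in U -> v \in U ->
  heckeElt psi nu (u * g * v) =
    (psinu psi nu u * psinu psi nu v) *: heckeElt psi nu g.
Proof.
move=> uU vU; apply: val_inj; rewrite /= !geltM.
exact: eigen_mul (eidem_gelt uU) (gelt_eidem psi nu vU).
Qed.

Lemma psinu_neq0 u : u \in U -> psinu psi nu u != 0.
Proof.
by move=> uU; apply: contra_eq_neq (psinuV psi nu uU) => ->; rewrite mul0r eq_sym oner_eq0.
Qed.

(** The element [e u g e = e g v e] is the multiple of [e g e] by the character value at [u], and
    also by that at [v]. *)
Lemma heckeElt_eq0 u g v : u \in U -> v \in U -> (u * g = g * v)%g ->
  psinu psi nu u != psinu psi nu v -> heckeElt psi nu g = 0.
Proof.
move=> uU vU ugv neq_uv.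
have := heckeElt_unitri g uU (group1 (unitri_group F m)).
have := heckeElt_unitri g (group1 (unitri_group F m)) vU.
rewrite mul1g mulg1 ugv => -> /eqP; rewrite psinu1 mul1r mulr1.
rewrite -subr_eq0 -scalerBl scaler_eq0 subr_eq0 eq_sym (negPf neq_uv).
by move/eqP.
Qed.

Lemma hecke_expand (h : heckeA psi m nu) :
  h = \sum_g vsval h g *: heckeElt psi nu g.
Proof.
apply: val_inj; rewrite linear_sum /=.
have [y hE] := cornerP _ _ (valP h).
have ehe : vsval h = e * vsval h * e.
  by rewrite [vsval h]hE -!mulrA eidem_idem !mulrA eidem_idem.
rewrite [LHS]ehe {1}[vsval h]galg_expand mulr_sumr mulr_suml.
by apply: eq_bigr => g _; rewrite [LHS]mulr_scale_mid.
Qed.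

End HeckeElements.

(** The Bruhat decomposition reduces this to a monomial [h]. Unless [e h e] vanishes, comparing root
    elements at the ascents of [h] gives the shape required by [monomial_vGL]. *)
Lemma heckeElt_whittaker (F : finFieldType) (C : numFieldType)
    (psi : addchar F C) m (g : {'GL_m[F]}) :
  (exists t, psi t <> 1) -> (0 < m)%N ->
  exists f (a : C), inM (nu := [:: m]) (const_mx f) /\
    heckeElt psi [:: m] g = a *: heckeT psi m (nu := [:: m]) (const_mx f).
Proof.
move=> [z0 /eqP psi_z0] m_gt0.
have [u [v [s [t [uU vU hE]]]]] := bruhat_unitri g.
have [h hdef] : exists h, h = (u * g * v)%g by exists (u * g * v)%g.
rewrite -hdef in hE.
have [b ->] : exists b, heckeElt psi [:: m] g = b *: heckeElt psi [:: m] h.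
  exists (psinu psi [:: m] u * psinu psi [:: m] v)^-1.
  rewrite hdef heckeElt_unitri // scalerA mulVf ?scale1r //.
  by rewrite mulf_neq0 ?psinu_neq0.
have [h0|hn0] := eqVneq (heckeElt psi [:: m] h) 0.
  (* Any admissible polynomial will do here, with coefficient 0. *)
  exists ('X^m + 1), 0; rewrite h0 scaler0 scale0r; split=> //.
  apply/inM_polyP; split.
  - by rewrite -[1]opprK -polyCN monicXnsubC.
  - by rewrite !hornerE expr0n gtn_eqF // add0r oner_eq0.
  by rewrite /deg -[1]opprK -polyCN size_XnsubC.
suff [f fM hT] : exists2 f : {poly F}, inM (nu := [:: m]) (const_mx f)
    & h = vGL (nu := [:: m]) (const_mx f) m.
  by exists f, b; split; [exact: fM|rewrite hT].
have hE' r c : xpredT r -> GLval h r c = t r *+ (c == s r) by [].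
apply: (monomial_vGL m_gt0 hE) => r r' r'E lts.
have ltr : (r < r')%N by rewrite r'E.
have not_psums : r.+1 \notin psums [:: m].
  rewrite /psums /= inE -r'E neq_ltn -[ltnRHS](prednK m_gt0).
  by rewrite ltn_ord.
(* Moving the root element at [(r, r')] with parameter [z] to the right of [h] gives the one at
   [(s r, s r')] with parameter [z * t r' / t r]; as [e h e] is nonzero, the character agrees on
   both. *)
have psi_eq z : psi z = psinu psi [:: m] (xroot (s r) (s r') (z * t r' / t r)).
  apply/eqP; apply: contraNT hn0 => neq; apply/eqP.
  have nrr' : r != r' by rewrite -val_eqE ltn_eqF.
  have nss' : s r != s r' by rewrite -val_eqE ltn_eqF.
  apply: (heckeElt_eq0 (xroot_unitri z ltr)
    (xroot_unitri (z * t r' / t r) lts)).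
    apply: GL_inj => i j; rewrite !GL_MxE !xrootE // mulmxDl mul1mx.
    rewrite mulmxDr mulmx1 mxE [RHS]mxE; congr (_ + _).
    rewrite -scalemxAl -scalemxAr [LHS]mxE [RHS]mxE.
    have -> : (delta_mx r r' *m GLval h) i j = (i == r)%:R * GLval h r' j.
      rewrite mxE (bigD1 r') //= mxE eqxx andbT big1 ?addr0 // => k /negPf kr.
      by rewrite mxE kr andbF mul0r.
    have -> : (GLval h *m delta_mx (s r) (s r')) i j
        = GLval h i (s r) * (j == s r')%:R.
      rewrite mxE (bigD1 (s r)) //= mxE eqxx /= big1 ?addr0 // => k /negPf kr.
      by rewrite mxE kr /= mulr0.
    rewrite !hE (inj_eq (fun x y => monomial_row_inj hE' (x:=x) (y:=y) isT isT)).
    have tr := monomial_row_neq0 hE' (r := r) isT.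
    rewrite [r == i]eq_sym; have [->|_] := eqVneq i r; last by rewrite !(mulr0n, mul0r, mulr0).
    by rewrite mul1r mulr1n mulrA divfK // -[t r' *+ _]mulr_natr mulrA.
  by rewrite psinu_xroot // r'E eqxx not_psums.
have tr := monomial_row_neq0 hE' (r := r) isT.
have tr' := monomial_row_neq0 hE' (r := r') isT.
(* If [s r'] does not follow [s r] immediately, the right-hand side of [psi_eq] is 1 for every [z],
   contradicting the choice of [z0]. *)
have [sE|nsE] := eqVneq (s r' : nat) (s r).+1; last first.
  by have := psi_eq z0; rewrite psinu_xroot // (negPf nsE) /= => /eqP; rewrite (negPf psi_z0).
split=> //; apply/eqP; apply: contraNT psi_z0 => neq_t.
have not_psums' : (s r).+1 \notin psums [:: m].
  rewrite /psums /= inE -sE neq_ltn -[ltnRHS](prednK m_gt0).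
  by rewrite ltn_ord.
(* The solution of [y * (t r' / t r - 1) = z0]; then [psi_eq] at [y] gives [psi z0 = 1]. *)
pose y := z0 / (t r' / t r - 1).
have d0 : t r' / t r - 1 != 0.
  by rewrite subr_eq0; apply: contraNneq neq_t => /(canRL (divfK tr)) ->; rewrite mul1r.
have -> : z0 = y * t r' / t r - y.
  by rewrite -mulrA -{2}[y]mulr1 -mulrBr divfK.
have := psi_eq y; rewrite psinu_xroot // sE eqxx not_psums' /= => psi_y.
by rewrite addcharD -psi_y -addcharD subrr addchar0.
Qed.

(** * Block diagonal matrices and the unipotent radical *)

Lemma nth_psums (mu : seq nat) i :
  (i < size mu)%N -> nth 0%N (psums mu) i = sumn (take i.+1 mu).
Proof.
move=> imu; rewrite /psums nth_scanl // -[RHS]add0n.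
by elim: (take _ mu) 0%N => [|y s IHs] z /=; rewrite ?addn0 // IHs addnA.
Qed.

Lemma mem_psums (mu : seq nat) x :
  x \in psums mu -> exists2 i, (i < size mu)%N & x = sumn (take i.+1 mu).
Proof.
move=> xmu; have xs : (index x (psums mu) < size mu)%N.
  by rewrite -[ltnRHS](size_scanl addn 0%N mu) index_mem.
by exists (index x (psums mu)); rewrite // -nth_psums // nth_index.
Qed.

Lemma psums_take (mu : seq nat) i :
  (i < size mu)%N -> sumn (take i.+1 mu) \in psums mu.
Proof. by move=> imu; rewrite -nth_psums // mem_nth // size_scanl. Qed.

Section BlockIndices.
Variables (n : nat) (mu : seq nat).
Hypotheses (n_gt0 : (0 < n)%N) (mu_comp : is_composition n mu).
Local Notation I := 'I_n.-1.+1.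
Local Notation sz i := (nth 0%N mu i).

Let mu_n : sumn mu = n. Proof. by have /andP[_ /eqP] := mu_comp. Qed.

Fact block_lt (r : I) : (r < sumn mu)%N.
Proof. by rewrite mu_n -[ltnRHS](prednK n_gt0). Qed.

Lemma block_size_gt0 i : (i < size mu)%N -> (0 < sz i)%N.
Proof. by have /andP[/allP mu_gt0 _] := mu_comp => imu; apply/mu_gt0/mem_nth. Qed.

(** Locked, so that it is handled through its value, given by [val_block]. *)
Definition block (r : I) : 'I_(size mu) :=
  locked (Ordinal (reshape_indexP (block_lt r))).

Lemma val_block r : block r = reshape_index mu r :> nat.
Proof. by rewrite /block -lock. Qed.

(** The parameter [i] keeps the type independent of [r]; the result is meaningful only when [r] lies
    in block [i]. *)
Definition block_off i (r : I) : 'I_(sz i).-1.+1 := inord (reshape_offset mu r).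

Definition block_elt (i : 'I_(size mu)) (j : 'I_(sz i).-1.+1) : I :=
  inord (flatten_index mu i j).

Lemma block_off_lt (i : 'I_(size mu)) (j : 'I_(sz i).-1.+1) : (j < sz i)%N.
Proof. by rewrite -[ltnRHS](prednK (block_size_gt0 (ltn_ord i))). Qed.

Lemma val_block_elt i j : block_elt (i := i) j = (sumn (take i mu) + j)%N :> nat.
Proof.
by rewrite inordK // [n.-1.+1]prednK // -[ltnRHS]mu_n; apply/flatten_indexP/block_off_lt.
Qed.

Lemma block_eltK i j : block (block_elt (i := i) j) = i.
Proof.
apply: ord_inj; rewrite val_block val_block_elt.
by rewrite -/(flatten_index mu i j) flatten_indexKl ?block_off_lt.
Qed.

Lemma block_off_elt i : cancel (@block_elt i) (@block_off i).
Proof.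
move=> j; apply: ord_inj; rewrite /block_off val_block_elt.
by rewrite -/(flatten_index mu i j) flatten_indexKr ?block_off_lt // inord_val.
Qed.

Lemma block_elt_off r i : block r = i -> block_elt (block_off i r) = r.
Proof.
move=> <-; apply: ord_inj; rewrite val_block_elt inordK; last first.
  rewrite [ltnRHS]prednK ?block_size_gt0 // val_block.
  exact: reshape_offsetP (block_lt r).
by rewrite val_block; exact: reshape_indexK.
Qed.

Lemma block_ltn r c : (block r < block c)%N -> (r < c)%N.
Proof.
move=> rc; rewrite -(block_elt_off (erefl (block r))).
rewrite -(block_elt_off (erefl (block c))) !val_block_elt.
set j := block_off _ r; have jlt := block_off_lt j.
apply: (@leq_trans (sumn (take (block r).+1 mu))).
  by rewrite (take_nth 0%N) // sumn_rcons ltn_add2l.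
by rewrite -(subnKC rc) takeD sumn_cat -addnA leq_addr.
Qed.

(** Translates the condition in [psinu] into blocks: the partial sums are the places where one block
    ends and the next begins. *)
Lemma psums_block (r c : I) : c = r.+1 :> nat ->
  (r.+1 \in psums mu) = (block r != block c).
Proof.
move=> cE.
have offE i : exists2 j, (j < sz (block i))%N &
    i = (sumn (take (block i) mu) + j)%N :> nat.
  exists (block_off (block i) i); first exact: block_off_lt.
  by rewrite -val_block_elt block_elt_off.
have [[j jlt rE] [k klt cE']] := (offE r, offE c).
have mono x y : (x <= y)%N -> (sumn (take x mu) <= sumn (take y mu))%N.
  by move=> xy; rewrite -(subnKC xy) takeD sumn_cat leq_addr.
have takeS (i : 'I_(size mu)) : sumn (take i.+1 mu) = (sumn (take i mu) + sz i)%N.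
  by rewrite (take_nth 0%N) // sumn_rcons.
apply/idP/idP => [/mem_psums[i imu iE]|nrc].
  apply/eqP=> rc; rewrite -rc in cE' klt *.
  have [ir|ri] := ltnP i (block r).
    by have := mono _ _ ir; lia.
  have := mono (block r).+1 i.+1 ri; rewrite takeS; lia.
have rc : (block r < block c)%N.
  rewrite ltnNge leq_eqVlt; apply/negP => /orP[/eqP/val_inj crE|/block_ltn].
    by rewrite crE eqxx in nrc.
  by rewrite cE ltnNge leqnSn.
have := mono _ _ rc; rewrite takeS => le_c.
have -> : r.+1 = sumn (take (block r).+1 mu) by rewrite takeS; lia.
exact: psums_take.
Qed.

Lemma block_sum (V : nmodType) (G : I -> V) :
  \sum_r G r = \sum_(i < size mu) \sum_j G (block_elt (i := i) j).
Proof.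
rewrite (partition_big block predT) //=; apply: eq_bigr => i _.
rewrite (reindex (@block_elt i)) /=; last first.
  exists (@block_off i) => [j _|r /eqP]; first exact: block_off_elt.
  exact: block_elt_off.
by apply: eq_bigl => j; rewrite block_eltK eqxx.
Qed.

End BlockIndices.

(** * The Levi decomposition of the parabolic subgroup and the characters on its factors *)

Section BlockMatrices.
Variables (F : finFieldType) (n : nat) (mu : seq nat).
Hypotheses (n_gt0 : (0 < n)%N) (mu_comp : is_composition n mu).
Local Notation I := 'I_n.-1.+1.
Local Notation sz i := (nth 0%N mu i).
Local Notation GL := {'GL_n[F]}.
Local Notation blk := (block n_gt0 mu_comp).
Local Notation off := (@block_off n mu).
Local Notation elt i := (@block_elt n mu i).
Local Notation P := (parabolic F n mu).
Local Notation L := (levi F n mu).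
Implicit Types (p q : GL) (i : 'I_(size mu)).

Lemma parabolicP p :
  reflect (forall r c : I, (blk c < blk r)%N -> GLval p r c = 0) (p \in P).
Proof.
rewrite inE; apply: (iffP forallP) => [H r c rc|H r].
  rewrite !val_block in rc.
  by have /forallP/(_ c)/implyP/(_ rc)/eqP := H r.
by apply/forallP=> c; apply/implyP=> rc; apply/eqP/H; rewrite !val_block.
Qed.

Lemma leviP p :
  reflect (forall r c : I, blk c != blk r -> GLval p r c = 0) (p \in L).
Proof.
rewrite inE; apply: (iffP forallP) => [H r c rc|H r].
  rewrite -val_eqE /= !val_block in rc.
  by have /forallP/(_ c)/implyP/(_ rc)/eqP := H r.
apply/forallP=> c; apply/implyP=> rc; apply/eqP/H.
by rewrite -val_eqE /= !val_block.
Qed.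

Lemma levi_parabolic : L \subset P.
Proof.
apply/subsetP=> l /leviP lL; apply/parabolicP=> r c rc; apply: lL.
by rewrite -val_eqE ltn_eqF.
Qed.

Lemma parabolic_group_set : group_set P.
Proof.
apply/group_setP; split.
  by apply/parabolicP=> r c rc; rewrite GL_1E mxE; case: eqP rc => // ->; rewrite ltnn.
move=> p q /parabolicP pP /parabolicP qP; apply/parabolicP=> r c rc.
rewrite GL_MxE mxE big1 // => k _; have [kr|rk] := ltnP (blk k) (blk r).
  by rewrite pP // mul0r.
by rewrite qP ?mulr0 // (leq_trans rc).
Qed.
Canonical parabolic_group := Group parabolic_group_set.

Definition submat i (p : GL) : 'M[F]_((sz i).-1.+1) :=
  \matrix_(j, k) GLval p (elt i j) (elt i k).

Lemma submat1 i : submat i 1 = 1%:M.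
Proof.
apply/matrixP=> j k; rewrite !mxE.
by rewrite (can_eq (block_off_elt n_gt0 mu_comp (i := i))).
Qed.

(** Among the intermediate indices, those in blocks before [i] kill the entry of [p], those in
    blocks after [i] the entry of [q]. *)
Lemma submatM i p q : p \in P -> q \in P ->
  submat i (p * q)%g = submat i p *m submat i q.
Proof.
move=> /parabolicP pP /parabolicP qP; apply/matrixP=> j k.
rewrite [LHS]mxE GL_MxE mxE (block_sum n_gt0 mu_comp) (bigD1 i) //=.
rewrite [RHS]mxE [X in _ + X]big1 => [|i' ii'].
  by rewrite addr0; apply: eq_bigr => l _; rewrite !mxE.
rewrite big1 // => l _; case: (ltngtP i' i) => i'i.
- by rewrite pP ?block_eltK // mul0r.
- by rewrite qP ?block_eltK // mulr0.
by case/eqP: ii'; apply/val_inj.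
Qed.

Definition diag_part p i : {'GL_(sz i)[F]} :=
  insubd (1%g : {'GL_(sz i)[F]}) (submat i p).

(** The inverse of a diagonal block of [p] is that block of [p^-1], which is again in [P]; so
    [diag_part] does not take its default value. *)
Lemma diag_partE p i j k : p \in P ->
  GLval (diag_part p i) j k = GLval p (elt i j) (elt i k).
Proof.
move=> pP; rewrite [GLval _]insubdK ?mxE //.
have /mulmx1_unit[] // : submat i p *m submat i p^-1 = 1%:M.
by rewrite -submatM ?groupV // mulgV submat1.
Qed.

Lemma diag_partM p q i : p \in P -> q \in P ->
  diag_part (p * q) i = (diag_part p i * diag_part q i)%g.
Proof.
move=> pP qP; apply: GL_inj => j k; rewrite diag_partE ?groupM //.
have /matrixP/(_ j k) := submatM i pP qP; rewrite !mxE => ->.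
by apply: eq_bigr => l _; rewrite !diag_partE // !mxE.
Qed.

Lemma diag_part1 i : diag_part 1 i = 1%g.
Proof.
apply: GL_inj => j k; rewrite diag_partE ?group1 //.
by have /matrixP/(_ j k) := submat1 i; rewrite mxE => ->.
Qed.

Lemma diag_partV p i : p \in P -> diag_part p^-1 i = (diag_part p i)^-1%g.
Proof.
move=> pP; apply: (mulgI (diag_part p i)).
by rewrite -diag_partM ?groupV // !mulgV diag_part1.
Qed.

Implicit Types g h : forall i : 'I_(size mu), {'GL_(sz i)[F]}.

Definition bdmx g : 'M[F]_n.-1.+1 :=
  \matrix_(r, c) if blk r == blk c
    then GLval (g (blk r)) (off (blk r) r) (off (blk r) c) else 0.

Lemma bdmx_elt g i j k : bdmx g (elt i j) (elt i k) = GLval (g i) j k.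
Proof. by rewrite mxE !block_eltK eqxx !block_off_elt. Qed.

Lemma bdmxM g h : bdmx g *m bdmx h = bdmx (fun i => g i * h i)%g.
Proof.
apply/matrixP=> r c; rewrite [LHS]mxE [RHS]mxE; case: eqP => [rc|/eqP nrc]; last first.
  rewrite big1 // => k _; rewrite !mxE; case: eqP => [<-|]; last by rewrite mul0r.
  by rewrite (negPf nrc) mulr0.
rewrite (block_sum n_gt0 mu_comp) (bigD1 (blk r)) //= [X in _ + X]big1 => [|i ir].
  rewrite addr0 [RHS]mxE; apply: eq_bigr => l _; rewrite !mxE !block_eltK -rc !eqxx.
  by rewrite !block_off_elt.
by rewrite big1 // => l _; rewrite !mxE !block_eltK eq_sym (negPf ir) mul0r.
Qed.

Lemma bdmx1 : bdmx (fun=> 1%g) = 1%:M.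
Proof.
apply/matrixP=> r c; rewrite [LHS]mxE [RHS]mxE; case: eqP => [rc|]; last by case: eqP => // ->.
rewrite GL_1E mxE; congr (nat_of_bool _)%:R; apply/eqP/eqP => [|->//].
move/(congr1 (elt (blk r))); rewrite !block_elt_off //.
Qed.

Definition block_diag g : GL := insubd (1%g : GL) (bdmx g).

Lemma block_diagE g : GLval (block_diag g) = bdmx g.
Proof.
rewrite [LHS]insubdK //.
have /mulmx1_unit[] // : bdmx g *m bdmx (fun i => (g i)^-1%g) = 1%:M.
rewrite bdmxM -bdmx1; congr bdmx.
by apply: functional_extensionality_dep => i; rewrite mulgV.
Qed.

Lemma block_diagM g h :
  block_diag (fun i => g i * h i)%g = (block_diag g * block_diag h)%g.
Proof. by apply: GL_inj => r c; rewrite GL_MxE !block_diagE bdmxM. Qed.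

Lemma block_diag1 : block_diag (fun=> 1%g) = 1%g.
Proof. by apply: GL_inj => r c; rewrite block_diagE bdmx1 GL_1E. Qed.

Lemma block_diagV g : block_diag (fun i => (g i)^-1%g) = (block_diag g)^-1%g.
Proof.
apply: (mulgI (block_diag g)); rewrite -block_diagM mulgV -block_diag1.
by congr block_diag; apply: functional_extensionality_dep => i; rewrite mulgV.
Qed.

Lemma block_diag_levi g : block_diag g \in L.
Proof.
by apply/leviP=> r c rc; rewrite block_diagE mxE eq_sym (negPf rc).
Qed.

Lemma block_diag_parabolic g : block_diag g \in P.
Proof. exact/(subsetP levi_parabolic)/block_diag_levi. Qed.

Lemma diag_part_block_diag g i : diag_part (block_diag g) i = g i.
Proof.
apply: GL_inj => j k.
by rewrite diag_partE ?block_diag_parabolic // block_diagE bdmx_elt.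
Qed.

Lemma levi_block_diag p : p \in L -> p = block_diag (diag_part p).
Proof.
move=> pL; have pP := subsetP levi_parabolic _ pL.
apply: GL_inj => r c; rewrite block_diagE mxE; case: eqP => [rc|/eqP rc].
  by rewrite diag_partE // !block_elt_off.
by rewrite (leviP _ pL) // eq_sym.
Qed.

(** The unipotent radical, as the kernel of [diag_part] on [P]. *)
Definition unirad : {set GL} :=
  [set p in P | [forall i, diag_part p i == 1%g]].

Lemma uniradP p :
  reflect (p \in P /\ forall i, diag_part p i = 1%g) (p \in unirad).
Proof.
rewrite [p \in unirad]in_set; apply: (iffP andP) => -[pP p1].
  by split=> // i; apply/eqP/(forallP p1).
split=> //; apply/forallP=> i; apply/eqP; exact: p1.
Qed.

Lemma unirad_group_set : group_set unirad.
Proof.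
apply/group_setP; split.
  by apply/uniradP; split=> [|i]; rewrite ?group1 // diag_part1.
move=> p q /uniradP[pP p1] /uniradP[qP q1]; apply/uniradP; split=> [|i].
  exact: groupM.
by rewrite diag_partM // p1 q1 mulg1.
Qed.
Canonical unirad_group := Group unirad_group_set.

Lemma unirad_conj g p : p \in unirad -> (p ^ block_diag g)%g \in unirad.
Proof.
move=> /uniradP[pP p1]; have gP := block_diag_parabolic g.
apply/uniradP; split=> [|i]; first by rewrite !groupM ?groupV.
rewrite conjgE !diag_partM ?groupM ?groupV // diag_partV // p1 mul1g.
exact: mulVg.
Qed.

Lemma parabolic_unirad p : p \in P ->
  exists2 q, q \in unirad & p = (block_diag (diag_part p) * q)%g.
Proof.
move=> pP; exists ((block_diag (diag_part p))^-1 * p)%g; last by rewrite mulKVg.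
have dP := block_diag_parabolic (diag_part p).
apply/uniradP; split=> [|i]; first by rewrite groupM ?groupV.
by rewrite diag_partM ?groupV // diag_partV // diag_part_block_diag mulVg.
Qed.

Lemma unirad_unitri p : p \in unirad -> p \in unitri F n.
Proof.
move=> /uniradP[pP p1]; apply/unitriP=> r c cr.
case: (ltngtP (blk c) (blk r)) => [rc|/block_ltn|/val_inj rc].
- rewrite (parabolicP _ pP) //; case: eqP rc => // ->; by rewrite ltnn.
- by rewrite ltnNge cr.
rewrite -(block_elt_off (erefl (blk r))) -(block_elt_off rc).
rewrite -diag_partE // p1 GL_1E mxE.
by rewrite (can_eq (block_off_elt n_gt0 mu_comp (i := blk r))).
Qed.

Lemma unitri_parabolic u : u \in unitri F n -> u \in P.
Proof.
move=> /unitriP uU; apply/parabolicP=> r c rc.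
have cr := block_ltn rc; rewrite uU 1?ltnW //.
by rewrite -val_eqE gtn_eqF.
Qed.

Lemma diag_part_unitri u i : u \in unitri F n ->
  diag_part u i \in unitri F (sz i).
Proof.
move=> uU; have uP := unitri_parabolic uU; apply/unitriP=> j k kj.
rewrite diag_partE // (unitriP _ uU) ?val_block_elt ?leq_add2l //.
by rewrite (can_eq (block_off_elt n_gt0 mu_comp (i := i))).
Qed.

Lemma block_diag_unitri g :
  (forall i, g i \in unitri F (sz i)) -> block_diag g \in unitri F n.
Proof.
move=> gU; apply/unitriP=> r c cr; rewrite block_diagE mxE.
case: eqP => [rc|nrc]; last by case: eqP nrc => // ->.
have rE := block_elt_off (erefl (blk r)); have cE := block_elt_off (esym rc).
rewrite (unitriP _ (gU _)); last first.
  rewrite -(leq_add2l (sumn (take (blk r) mu))).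
  by rewrite -!(val_block_elt n_gt0 mu_comp) rE cE.
congr (nat_of_bool _)%:R; apply/eqP/eqP => [|->//].
by move/(congr1 (elt (blk r))); rewrite rE cE.
Qed.

Section Characters.
Variables (C : numFieldType) (psi : addchar F C).

(** Only superdiagonal entries within a block count in [psinu], and on the unipotent radical these
    vanish. *)
Lemma psinu_unirad p : p \in unirad -> psinu psi mu p = 1.
Proof.
move=> pN; have /uniradP[pP p1] := pN; rewrite /psinu big1 ?addchar0 // => r _.
rewrite big1 // => c /andP[/eqP cE]; rewrite (psums_block n_gt0 mu_comp cE).
rewrite negbK => /eqP rc.
have rE := block_elt_off (erefl (blk r)); have cE' := block_elt_off (esym rc).
have := diag_partE (off (blk r) r) (off (blk r) c) pP.
rewrite rE cE' p1 => <-; rewrite GL_1E mxE; case: eqP => //.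
by move/(congr1 (elt (blk r))); rewrite rE cE' => rc'; move: cE; rewrite -rc'; lia.
Qed.

(** The superdiagonal positions outside the partial sums of [mu] are those within the blocks, and
    [[:: sz i]] excludes none of these. *)
Lemma psinu_block_diag g :
  psinu psi mu (block_diag g) = \prod_(i < size mu) psinu psi [:: sz i] (g i).
Proof.
rewrite /psinu -(big_morph psi (addcharD psi) (addchar0 psi)); congr (psi _).
rewrite (block_sum n_gt0 mu_comp); apply: eq_bigr => i _; apply: eq_bigr => j _.
rewrite big_mkcond (block_sum n_gt0 mu_comp) (bigD1 i) //= [X in _ + X]big1 => [|i' ii'].
  rewrite addr0 [RHS]big_mkcond; apply: eq_bigr => k _.
  rewrite block_diagE bdmx_elt; congr (if _ then _ else _).
  rewrite !(val_block_elt n_gt0 mu_comp) -addnS eqn_add2l.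
  have [kE|//] := eqVneq (k : nat) j.+1.
  rewrite addnS -(val_block_elt n_gt0 mu_comp) (psums_block n_gt0 mu_comp (c := elt i k)).
    rewrite !block_eltK eqxx /= /psums /= inE -kE neq_ltn.
    by rewrite -[ltnRHS](prednK (block_size_gt0 mu_comp (ltn_ord i))) ltn_ord.
  by rewrite !(val_block_elt n_gt0 mu_comp) kE addnS.
rewrite big1 // => k _; case: ifP => // _.
by rewrite block_diagE mxE !block_eltK eq_sym (negPf ii').
Qed.

End Characters.
End BlockMatrices.

Section BlockMonomial.
Variables (F : finFieldType) (n : nat) (mu : seq nat).
Hypotheses (n_gt0 : (0 < n)%N) (mu_comp : is_composition n mu).
Local Notation I := 'I_n.-1.+1.
Local Notation sz i := (nth 0%N mu i).
Local Notation blk := (block n_gt0 mu_comp).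

Lemma block_interval (i : 'I_(size mu)) (r : I) :
  (sumn (take i mu) <= r < sumn (take i mu) + sz i)%N = (blk r == i).
Proof.
apply/idP/eqP => [ri|<-].
  have ri' : (r - sumn (take i mu) < sz i)%N by lia.
  apply: ord_inj; rewrite val_block -(flatten_indexKl ri').
  by rewrite /flatten_index subnKC //; case/andP: ri.
have := block_off_lt mu_comp (block_off mu (blk r) r).
have := val_block_elt n_gt0 mu_comp (block_off mu (blk r) r).
by rewrite block_elt_off //; lia.
Qed.

(** The off-diagonal entries 1 have degree 0, so their blocks are empty and diagonal block [i]
    starts at the sum of the preceding parts. *)
Lemma block_diag_vGL (f : 'I_(size mu) -> {poly F}) :
  (forall i : 'I_(size mu), inM (nu := [:: sz i]) (const_mx (f i))) ->
  block_diag n_gt0 mu_comp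
    (fun i => vGL (nu := [:: sz i]) (const_mx (f i)) (sz i)) =
  vGL (diag_poly f) n.
Proof.
move=> fM; have df i : deg (f i) = sz i by have [_ _ ->] := (inM_polyP _ _).1 (fM i).
have sz_gt0 (i : 'I_(size mu)) := block_size_gt0 mu_comp (ltn_ord i).
apply: GL_inj => r c; rewrite block_diagE vGLE //; last exact: diag_poly_inM.
have d0 i j : i != j -> deg (diag_poly f i j) = 0%N.
  by move=> /negPf ij; rewrite mxE ij /deg size_poly1.
have vblockE i j : vblock (diag_poly f) i j r c =
    if (i == j) && (blk r == i) && (blk c == i)
    then vpoly (f i) (r - sumn (take i mu)) (c - sumn (take i mu)) else 0.
  rewrite /vblock; have [->|ij] := eqVneq i j; last first.
    by rewrite d0 // addn0; case: ifP => //; lia.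
  rewrite /row_start /col_start !big1 ?addn0 => [|s js|s js].
  - by rewrite mxE eqxx df !block_interval.
  - by rewrite d0 // eq_sym -val_eqE ltn_eqF.
  - by rewrite d0 // -val_eqE ltn_eqF.
rewrite [LHS]mxE [RHS]mxE (bigD1 (blk r)) //= [X in _ = X + _](bigD1 (blk r)) //=.
rewrite vblockE !eqxx /= [X in _ + X + _]big1 => [|j ij]; last first.
  by rewrite vblockE eq_sym (negPf ij).
rewrite addr0 [X in _ + X]big1 => [|i ir]; last first.
  by rewrite big1 // => j _; rewrite vblockE [blk r == i]eq_sym (negPf ir) andbF.
rewrite addr0 [blk c == _]eq_sym; case: eqP => // rc.
rewrite vGLE ?is_composition1 // vmx_poly //.
have offE (x : I) : blk x = blk r ->
    block_off mu (blk r) x = (x - sumn (take (blk r) mu))%N :> nat.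
  move=> xb; rewrite -{2}(block_elt_off xb) (val_block_elt n_gt0 mu_comp).
  by rewrite addKn.
by rewrite !offE.
Qed.

End BlockMonomial.

(** * Multilinear maps and group algebras of products *)

Lemma fprod_distr (K : comPzRingType) (I : finType) (T : I -> finType)
    (c : forall i, T i -> K) :
  \prod_i \sum_(j : T i) c i j = \sum_(J : fprod T) \prod_i c i (J i).
Proof.
pose P i := [ffun j => c i j].
transitivity (\prod_i \sum_(j : T i) P i j).
  by apply: eq_bigr => i _; apply: eq_bigr => j _; rewrite ffunE.
transitivity (\sum_(J : fprod T) \prod_i P i (J i)); last first.
  by apply: eq_bigr => J _; apply: eq_bigr => j _; rewrite ffunE.
rewrite (@big_fprod K 0 1 *%R +%R I _ P).
under eq_bigr do rewrite (big_tag (fun i => P i)).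
by rewrite bigA_distr_big_dep.
Qed.

Lemma dfwith_id (I : eqType) (T : I -> Type) (x : forall i, T i) i :
  dfwith x (x i) = x.
Proof.
apply: functional_extensionality_dep => j.
by have [<-|ji] := eqVneq i j; rewrite ?dfwith_in ?dfwith_out.
Qed.

Section Multilinear.
Variables (K : fieldType) (I : finType) (V : I -> falgType K) (W : lmodType K).

(* The hypothesis on [S] says that [S i] spans [V i]. *)
Lemma multilinear_eq0_spanning (f : (forall i, V i) -> W)
    (S : forall i, V i -> Prop) :
  multilinear f ->
  (forall i (Q : V i -> Prop), Q 0 ->
     (forall a u v, S i u -> Q v -> Q (a *: u + v)) -> forall v, Q v) ->
  (forall x, (forall i, S i (x i)) -> f x = 0) -> forall x, f x = 0.
Proof.
move=> mf spanS f0 x.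
(* The list [s] holds the arguments not yet restricted to spanning vectors; the induction treats
   them one at a time. *)
suff H (s : seq I) y : (forall i, i \notin s -> S i (y i)) -> f y = 0.
  by apply: (H (enum I)) => i; rewrite mem_enum.
elim: s y => [|i s IHs] y yS; first by apply: f0 => i; apply: yS.
have fz : f (dfwith y (0 : V i)) = 0.
  have := mf y i (-1) 0 0; rewrite scaler0 addr0 scaleN1r addNr; exact.
rewrite -(dfwith_id y i).
apply: (spanS i (fun u => f (dfwith y u) = 0)) => // a u v Su fv.
rewrite mf fv addr0 (IHs (dfwith y u)) ?scaler0 // => k.
case: dfwithP => [//|l il ls].
by apply: yS; rewrite inE eq_sym (negPf il).
Qed.

(** On pure tensors the difference of the two maps is multilinear, hence determined by spanning
    vectors. This serves the uniqueness of a map prescribed on the [T_(f)]. *)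
Lemma tensor_linear_ext (phi phi' : {linear tensor V -> W})
    (S : forall i, V i -> Prop) :
  (forall i (Q : V i -> Prop), Q 0 ->
     (forall a u v, S i u -> Q v -> Q (a *: u + v)) -> forall v, Q v) ->
  (forall x, (forall i, S i (x i)) -> phi (ptens x) = phi' (ptens x)) ->
  phi =1 phi'.
Proof.
move=> spanS eqS.
have eq_ptens x : phi (ptens x) - phi' (ptens x) = 0.
  apply: (multilinear_eq0_spanning
    (f := fun y => phi (ptens y) - phi' (ptens y)) _ spanS) => [y i a u v|y yS].
    by rewrite ptens_multilinear !linearD !linearZ addrACA.
  by rewrite eqS ?subrr.
elim/tensor_ind => [s t IHs IHt|a x]; first by rewrite !linearD /= IHs IHt.
by rewrite !linearZ /=; congr (_ *: _); apply/eqP; rewrite -subr_eq0 eq_ptens.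
Qed.

End Multilinear.

Section GroupAlgebraCoefficients.
Variables (K : fieldType) (gT : finGroupType).
Implicit Types x y : galg K gT.

Lemma gelt_mulE g y h : (gelt K g * y) h = y (g^-1 * h)%g.
Proof.
rewrite galgM (bigD1 g) //= ffunE eqxx mul1r big1 ?addr0 // => k /negPf kg.
by rewrite ffunE kg mul0r.
Qed.

End GroupAlgebraCoefficients.

Section ProductGroupAlgebra.
Variables (K : fieldType) (I : finType) (gT : I -> finGroupType).
Variables (G : finGroupType) (D : (forall i, gT i) -> G).
Hypothesis DM : forall g h, D (fun i => g i * h i)%g = (D g * D h)%g.
Implicit Types x y : forall i, galg K (gT i).

(** The image of the pure tensor of the [x i] under the linear extension of [D]. *)
Definition galg_prod x : galg K G :=
  \sum_(g : fprod gT) (\prod_i x i (g i)) *: gelt K (D g).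

Lemma galg_prod_multilinear (x : forall i, galg K (gT i)) i a u v :
  galg_prod (dfwith x (a *: u + v : galg K (gT i))) =
  a *: galg_prod (dfwith x u) + galg_prod (dfwith x v).
Proof.
rewrite scaler_sumr -big_split; apply: eq_bigr => g _ /=.
rewrite scalerA -scalerDl; congr (_ *: _).
rewrite !(bigD1 (P := predT) i) //= !dfwith_in galgD galgZ mulrDl mulrA.
by congr (_ * _ + _ * _); apply: eq_bigr => j ji; rewrite !dfwith_out // eq_sym.
Qed.

Lemma galg_prodZ (a : I -> K) x :
  galg_prod (fun i => a i *: x i) = (\prod_i a i) *: galg_prod x.
Proof.
rewrite scaler_sumr; apply: eq_bigr => g _; rewrite scalerA -big_split.
by congr (_ *: _); apply: eq_bigr => i _; rewrite galgZ.
Qed.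

Lemma galg_prod_gelt (g : forall i, gT i) :
  galg_prod (fun i => gelt K (g i)) = gelt K (D g).
Proof.
rewrite /galg_prod (bigD1 (fprod_of_fun g)) //= [X in _ + X]big1 ?addr0 => [|h hg].
  rewrite big1 ?scale1r => [|i _]; last by rewrite fprodE ffunE eqxx.
  by congr (gelt K (D _)); apply: functional_extensionality_dep => i; rewrite fprodE.
have [i hi] : exists i, h i != g i.
  apply/existsP; rewrite -negb_forall; apply: contra hg => /forallP hg.
  by apply/eqP/fprodP => i; rewrite fprodE; apply/eqP.
by rewrite (bigD1 i) //= ffunE (negPf hi) mul0r scale0r.
Qed.

(** Collecting the double sum by the product of the two indices, distributivity turns each
    coefficient into a product of convolutions. *)
Lemma galg_prodM x y : galg_prod x * galg_prod y = galg_prod (fun i => x i * y i).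
Proof.
rewrite mulr_suml.
transitivity (\sum_(h : fprod gT) \sum_(k : fprod gT)
    (\prod_i (x i (h i) * y i ((h i)^-1 * k i)%g)) *: gelt K (D k)).
  apply: eq_bigr => h _; rewrite mulr_sumr.
  rewrite [RHS](reindex (fun k : fprod gT => fprod_of_fun (fun i => h i * k i)%g)) /=; last first.
    exists (fun k : fprod gT => fprod_of_fun (fun i => (h i)^-1 * k i)%g) => k _;
      by apply/fprodP => i; rewrite !fprodE ?mulKg ?mulKVg.
  apply: eq_bigr => k _; rewrite -scalerAl -scalerAr scalerA -geltM -DM.
  rewrite -big_split; congr (_ *: gelt K (D _)).
    by apply: eq_bigr => i _; rewrite fprodE mulKg.
  by apply: functional_extensionality_dep => i; rewrite fprodE.
rewrite exchange_big; apply: eq_bigr => k _ /=; rewrite -scaler_suml.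
congr (_ *: _); rewrite -(fprod_distr (fun i h => x i h * y i (h^-1 * k i)%g)).
by apply: eq_bigr => i _; rewrite galgM.
Qed.

End ProductGroupAlgebra.

(** * The algebra of the Levi subgroup *)

Section LeviSubalgebra.
Variables (F : finFieldType) (C : numFieldType) (psi : addchar F C).
Variables (n : nat) (mu : seq nat).
Hypotheses (n_gt0 : (0 < n)%N) (mu_comp : is_composition n mu).
Local Notation sz i := (nth 0%N mu i).
Local Notation G := {'GL_n[F]}.
Local Notation A := (galg C G).
Local Notation bd := (block_diag n_gt0 mu_comp).
Local Notation dg := (@diag_part F n mu).
Local Notation N := (unirad F n mu).
Local Notation e := (eidem psi n mu).
Let gT (i : 'I_(size mu)) : finGroupType := {'GL_(sz i)[F]}.
Let ei (i : 'I_(size mu)) : galg C (gT i) := eidem psi (sz i) [:: sz i].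
Let psii (i : 'I_(size mu)) (g : gT i) : C := psinu psi [:: sz i] g.
Let B (x : forall i, galg C (gT i)) : A := galg_prod bd x.

Let BM x y : B x * B y = B (fun i => x i * y i).
Proof. exact: (galg_prodM (gT := gT) (block_diagM n_gt0 mu_comp)). Qed.

Lemma eidemE m nu (g : {'GL_m[F]}) : eidem psi m nu g =
  if g \in unitri F m then #|unitri F m|%:R^-1 * psinu psi nu g^-1%g else 0.
Proof.
rewrite galgZ galg_sum; case: ifP => gU; last first.
  rewrite big1 ?mulr0 // => u uU; rewrite galgZ ffunE.
  by case: eqP uU gU => [-> ->//|_]; rewrite mulr0.
rewrite (bigD1 g) //= galgZ ffunE eqxx mulr1 big1 ?addr0 // => u /andP[_ ug].
by rewrite galgZ ffunE eq_sym (negPf ug) mulr0.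
Qed.

(** Each element of the unitriangular group contributes the inverse of the group order. *)
Lemma sum_eidem_psinu m nu : \sum_g eidem psi m nu g * psinu psi nu g = 1.
Proof.
rewrite (bigID (mem (unitri F m))) /= [X in _ + X]big1 => [|g /negPf gU]; last first.
  by rewrite eidemE gU mul0r.
rewrite addr0 (eq_bigr (fun=> #|unitri F m|%:R^-1)) => [|g gU].
  by rewrite sumr_const -[X in X *+ _]mulr1 -mulrnAr mulVf // card_unitri_neq0.
by rewrite eidemE gU -mulrA [psinu _ _ _ * _]mulrC psinuV // mulr1.
Qed.

(** Replacing group elements by their eigenvalues turns [B ei] into a scalar, the product over the
    blocks of the sums of [sum_eidem_psinu]. *)
Lemma galg_prod_eidem_eigen (E : A) :
  (forall g : forall i, gT i, (forall i, g i \in unitri F (sz i)) ->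
     gelt C (bd g) * E = (\prod_i psii (g i)) *: E) ->
  B ei * E = E.
Proof.
move=> EE; rewrite mulr_suml.
transitivity (\sum_(g : fprod gT) (\prod_i (ei i (g i) * psii (g i))) *: E).
  apply: eq_bigr => g _; rewrite -scalerAl big_split /= -scalerA.
  have [gU|/forallPn[i giU]] := altP (@forallP _ (fun i => g i \in unitri F (sz i))).
    by rewrite EE.
  by rewrite (bigD1 i) //= eidemE (negPf giU) mul0r !scale0r.
rewrite -scaler_suml -(fprod_distr (fun i h => ei i h * psii h)).
by rewrite big1 ?scale1r // => i _; apply: sum_eidem_psinu.
Qed.

Lemma galg_prod_eidem_mul : B ei * e = e.
Proof.
apply: galg_prod_eidem_eigen => g gU; rewrite gelt_eidem ?psinu_block_diag //.
exact: block_diag_unitri.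
Qed.

Lemma eidem_mul_galg_prod : e * B ei = e.
Proof.
rewrite mulr_sumr.
transitivity (\sum_(g : fprod gT) (\prod_i (ei i (g i) * psii (g i))) *: e).
  apply: eq_bigr => g _; rewrite -[LHS]scalerAr big_split /= -scalerA.
  have [gU|/forallPn[i giU]] := altP (@forallP _ (fun i => g i \in unitri F (sz i))).
    by rewrite eidem_gelt ?psinu_block_diag // block_diag_unitri.
  by rewrite (bigD1 i) //= eidemE (negPf giU) mul0r !scale0r.
rewrite -scaler_suml -(fprod_distr (fun i h => ei i h * psii h)).
by rewrite big1 ?scale1r // => i _; apply: sum_eidem_psinu.
Qed.

Definition unirad_idem : A := #|N|%:R^-1 *: \sum_(u in N) gelt C u.
Local Notation rho := unirad_idem.

Let cardN_neq0 : #|N|%:R != 0 :> C.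
Proof. by rewrite pnatr_eq0 -lt0n (cardG_gt0 (unirad_group F n_gt0 mu_comp)). Qed.

Lemma unirad_idemE g : rho g = if g \in N then #|N|%:R^-1 else 0.
Proof.
rewrite galgZ galg_sum; case: ifP => gU; last first.
  rewrite big1 ?mulr0 // => u uU; rewrite ffunE.
  by case: eqP uU gU => [-> ->//|_].
rewrite (bigD1 g) //= ffunE eqxx big1 ?addr0 ?mulr1 // => u /andP[_ ug].
by rewrite ffunE eq_sym (negPf ug).
Qed.

Lemma gelt_unirad_idem u : u \in N -> gelt C u * rho = rho.
Proof.
move=> uN; apply/ffunP=> g; rewrite gelt_mulE !unirad_idemE.
by rewrite (groupMl (G := unirad_group F n_gt0 mu_comp)) // groupV.
Qed.

Lemma unirad_idem_absorbl (E : A) :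
  (forall u, u \in N -> gelt C u * E = E) -> rho * E = E.
Proof.
move=> EE; rewrite -scalerAl mulr_suml (eq_bigr _ EE) sumr_const.
by rewrite -scaler_nat scalerA mulVf // scale1r.
Qed.

Lemma unirad_idem_absorbr (E : A) :
  (forall u, u \in N -> E * gelt C u = E) -> E * rho = E.
Proof.
move=> EE; rewrite -scalerAr mulr_sumr (eq_bigr _ EE) sumr_const.
by rewrite -scaler_nat scalerA mulVf // scale1r.
Qed.

Lemma unirad_idem_idem : rho * rho = rho.
Proof. by apply: unirad_idem_absorbl => u; apply: gelt_unirad_idem. Qed.

Lemma eidem_gelt_unirad u : u \in N -> e * gelt C u = e.
Proof.
move=> uN; rewrite eidem_gelt ?(psinu_unirad n_gt0 mu_comp) ?scale1r //.
exact: unirad_unitri uN.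
Qed.

Lemma eidem_unirad_idem : e * rho = e.
Proof. exact/unirad_idem_absorbr/eidem_gelt_unirad. Qed.

(** Conjugation by a block diagonal element permutes [N]. *)
Lemma gelt_unirad_comm g : gelt C (bd g) * rho = rho * gelt C (bd g).
Proof.
rewrite -[LHS]scalerAr -[RHS]scalerAl; congr (_ *: _).
rewrite mulr_sumr mulr_suml (reindex_inj (conjg_inj (bd g))) /=.
apply: eq_big => [u|u uN]; last by rewrite -!geltM conjgE mulKVg.
apply/idP/idP => [uN|]; last exact: unirad_conj.
by rewrite -[u](conjgK (bd g)) -block_diagV; apply: unirad_conj.
Qed.

Lemma galg_prod_unirad_comm x : B x * rho = rho * B x.
Proof.
rewrite mulr_suml mulr_sumr; apply: eq_bigr => g _.
by rewrite -[LHS]scalerAl -[RHS]scalerAr gelt_unirad_comm.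
Qed.

Lemma eidem_factor : e = B ei * rho.
Proof.
have eigen u : u \in unitri F n ->
    gelt C u * (B ei * rho) = psinu psi mu u *: (B ei * rho).
  move=> uU; have uP := unitri_parabolic n_gt0 mu_comp uU.
  have [v vN uE] := parabolic_unirad n_gt0 mu_comp uP.
  have vU := unirad_unitri n_gt0 mu_comp vN.
  have dU i := diag_part_unitri n_gt0 mu_comp i uU.
  (* Once [rho] is moved to the left it absorbs the factor [v] of [u]; the block diagonal factor
     then acts on each [ei] by its character. *)
  rewrite {1}uE geltM galg_prod_unirad_comm -mulrA [gelt C v * _]mulrA gelt_unirad_idem //.
  rewrite -galg_prod_unirad_comm mulrA.
  rewrite -(galg_prod_gelt C (gT := gT) bd) -/(B _) BM.
  have -> : (fun i => gelt C (dg u i) * ei i) = (fun i => psii (dg u i) *: ei i).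
    by apply: functional_extensionality_dep => i; rewrite gelt_eidem ?dU.
  rewrite /B galg_prodZ -scalerAl; congr (_ *: _).
  rewrite [u in RHS]uE psinuM ?block_diag_unitri //.
  by rewrite (psinu_unirad n_gt0 mu_comp psi vN) mulr1 psinu_block_diag.
have eX : e * (B ei * rho) = B ei * rho.
  rewrite -scalerAl mulr_suml (eq_bigr (fun=> B ei * rho)) => [|u uU].
    rewrite sumr_const -scaler_nat scalerA mulVf ?scale1r //.
    exact: card_unitri_neq0.
  by rewrite -scalerAl eigen // scalerA mulrC psinuV // scale1r.
(* On the other hand, [e] absorbs both [B ei] and [rho]. *)
by rewrite -eX mulrA eidem_mul_galg_prod eidem_unirad_idem.
Qed.

Section Cornered.
Variable x : forall i, galg C (gT i).
Hypotheses (ex : forall i, ei i * x i = x i) (xe : forall i, x i * ei i = x i).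

(** In the factorization of [e] the [x i] absorb the [ei], so that only [rho] remains. *)
Lemma eidem_galg_prod : e * B x = B x * rho.
Proof.
rewrite eidem_factor galg_prod_unirad_comm -mulrA BM galg_prod_unirad_comm; congr (_ * B _).
exact: functional_extensionality_dep.
Qed.

Lemma galg_prod_eidem : B x * e = B x * rho.
Proof.
rewrite eidem_factor mulrA BM; congr (B _ * _).
exact: functional_extensionality_dep.
Qed.

Lemma eidem_galg_prod_eidem : e * B x * e = B x * rho.
Proof. by rewrite -mulrA galg_prod_eidem mulrA eidem_galg_prod -mulrA unirad_idem_idem. Qed.

End Cornered.

(** Two block diagonal elements in the same coset of [N] are equal, so a single term contributes. *)
Lemma galg_prod_unirad_coef x (g : forall i, gT i) :
  (B x * rho) (bd g) = #|N|%:R^-1 * \prod_i x i (g i).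
Proof.
rewrite mulr_suml galg_sum (bigD1 (fprod_of_fun g)) //= [X in _ + X]big1.
  rewrite addr0 -scalerAl galgZ gelt_mulE.
  have -> : (fprod_of_fun g : forall i, gT i) = g.
    by apply: functional_extensionality_dep => i; rewrite fprodE.
  rewrite mulVg unirad_idemE (group1 (unirad_group F n_gt0 mu_comp)).
  exact: mulrC.
move=> h hg; rewrite -scalerAl galgZ gelt_mulE unirad_idemE.
case: ifP => [|_]; last by rewrite mulr0.
rewrite -block_diagV -block_diagM => /uniradP[_ hg1]; case/eqP: hg.
apply/fprodP => i; rewrite fprodE; have := hg1 i.
by rewrite diag_part_block_diag => /(canRL (mulKVg _)); rewrite mulg1.
Qed.

(** The factor of [p] in [N] is absorbed by [e], as the character is trivial on it. *)
Lemma hecke_span_parabolic :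
  hecke_span psi mu (parabolic F n mu) = hecke_span psi mu (levi F n mu).
Proof.
apply/eqP; rewrite eqEsubv; apply/andP; split; apply/span_subvP => _ /mapP[p pX ->].
  rewrite mem_enum in pX; have [v vN pE] := parabolic_unirad n_gt0 mu_comp pX.
  have -> : heckeElt psi mu p = heckeElt psi mu (bd (dg p)).
    rewrite [in LHS]pE -[X in heckeElt _ _ X]mul1g.
    rewrite mulgA heckeElt_unitri ?group1 //; last exact: unirad_unitri vN.
    by rewrite psinu1 (psinu_unirad n_gt0 mu_comp psi vN) mulr1 scale1r.
  by apply/memv_span/map_f; rewrite mem_enum block_diag_levi.
apply/memv_span/map_f; rewrite mem_enum in pX; rewrite mem_enum.
exact: (subsetP (levi_parabolic F n_gt0 mu_comp)).
Qed.

Let H (i : 'I_(size mu)) : falgType C := heckeA psi (sz i) [:: sz i].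
Implicit Types y z : forall i, H i.

Lemma hecke_idl m nu (h : heckeA psi m nu) : eidem psi m nu * vsval h = vsval h.
Proof. by have [y ->] := cornerP _ _ (valP h); rewrite !mulrA eidem_idem. Qed.

Lemma hecke_idr m nu (h : heckeA psi m nu) : vsval h * eidem psi m nu = vsval h.
Proof. by have [y ->] := cornerP _ _ (valP h); rewrite -!mulrA eidem_idem. Qed.

(** Multiplying by [e] on both sides makes membership in the Hecke algebra evident; computations use
    the form in [val_levi_embed]. *)
Definition levi_embed y : heckeA psi n mu :=
  Subvs (mem_hecke psi mu (B (fun i => vsval (y i)))).

Lemma val_levi_embed y : vsval (levi_embed y) = B (fun i => vsval (y i)) * rho.
Proof. by apply: eidem_galg_prod_eidem => i; rewrite ?hecke_idl ?hecke_idr. Qed.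

Lemma levi_embed_multilinear : multilinear levi_embed.
Proof.
have valW y i (u : H i) :
    (fun j => vsval (dfwith y u j)) = dfwith (fun j => vsval (y j)) (vsval u).
  apply: functional_extensionality_dep => j.
  by have [<-|ji] := eqVneq i j; rewrite ?dfwith_in ?dfwith_out.
move=> y i a u v; apply: val_inj; rewrite /= !valW linearP.
by rewrite [B _]galg_prod_multilinear mulrDr mulrDl mulr_scale_mid.
Qed.

Lemma levi_embedM y z :
  levi_embed y * levi_embed z = levi_embed (fun i => y i * z i).
Proof.
apply: val_inj; change (vsval (levi_embed y) * vsval (levi_embed z)
  = vsval (levi_embed (fun i => y i * z i))).
rewrite !val_levi_embed -mulrA [rho * _]mulrA -galg_prod_unirad_comm -!mulrA.
by rewrite unirad_idem_idem mulrA BM.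
Qed.

Lemma levi_embed1 : levi_embed (fun i => 1) = 1.
Proof.
apply: val_inj; rewrite [RHS]heckeA1 [LHS]val_levi_embed eidem_factor.
by congr (B _ * _); apply: functional_extensionality_dep => i; rewrite heckeA1.
Qed.

(** The product of the [e_i g_i e_i] is [B ei * gelt C (bd g) * B ei], and the outer factors [e]
    absorb both [B ei]. *)
Lemma levi_embed_heckeElt (g : forall i, gT i) :
  levi_embed (fun i => heckeElt psi [:: sz i] (g i)) = heckeElt psi mu (bd g).
Proof.
apply: val_inj => /=; rewrite -(BM (fun i => ei i * gelt C (g i)) ei).
rewrite -(BM ei (fun i => gelt C (g i))) /B galg_prod_gelt -/(B _).
by rewrite !mulrA eidem_mul_galg_prod -[_ * _ * e]mulrA galg_prod_eidem_mul.
Qed.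

Lemma levi_embed_expand y :
  levi_embed y = \sum_(g : fprod gT) (\prod_i vsval (y i) (g i)) *: heckeElt psi mu (bd g).
Proof.
apply: val_inj; rewrite linear_sum /= mulr_sumr mulr_suml.
by apply: eq_bigr => g _; rewrite [LHS]mulr_scale_mid.
Qed.

Lemma levi_embed_coef y (g : forall i, gT i) :
  vsval (levi_embed y) (bd g) = #|N|%:R^-1 * \prod_i vsval (y i) (g i).
Proof. by rewrite val_levi_embed galg_prod_unirad_coef. Qed.

Variable phi : {linear tensor H -> heckeA psi n mu}.
Hypothesis phiE : forall y, phi (ptens y) = levi_embed y.

Lemma levi_linear_inj : injective phi.
Proof.
(* Coordinate functionals of the [H i], extended to the group algebras by the projection [vsproj].
   With them the coordinates of [s] are recovered from the coefficients of [phi s] at block diagonal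
   elements. *)
pose c (L : midx H) i (g : gT i) : C :=
  coord (vbasis {: H i}) (L i) (vsproj (hecke psi (sz i) [:: sz i]) (gelt C g)).
have recover (s : tensor H) (L : midx H) : s L = #|N|%:R *
    \sum_(g : fprod gT) (\prod_i c L i (g i)) * vsval (phi s) (bd g).
  elim/tensor_ind: s => [s t IHs IHt|a y].
    rewrite tensorD IHs IHt -mulrDr -big_split; congr (_ * _).
    by apply: eq_bigr => g _; rewrite linearD /= galgD mulrDr.
  rewrite tensorZ ffunE linearZ phiE mulr_sumr.
  (* For a pure tensor the sum over [g] factors over the blocks, each factor being a coordinate of
     [y i]. *)
  transitivity (a * \sum_(g : fprod gT) \prod_i (c L i (g i) * vsval (y i) (g i))).
    rewrite -(fprod_distr (fun i h => c L i h * vsval (y i) h)).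
    congr (_ * _); apply: eq_bigr => i _; rewrite -{1}[y i]vsvalK.
    rewrite {1}[vsval (y i)]galg_expand !linear_sum; apply: eq_bigr => h _.
    by rewrite !linearZ /= mulrC.
  rewrite mulr_sumr; apply: eq_bigr => g _.
  rewrite [vsval (a *: _)]linearZ galgZ levi_embed_coef big_split /=.
  by rewrite mulrCA [RHS]mulrCA; congr (_ * _); rewrite mulrCA mulVKf // mulrCA.
move=> s t st; apply/eqP; rewrite -subr_eq0; apply/eqP/ffunP => L.
rewrite recover linearB st subrr /= big1 ?mulr0 ?ffunE // => g _.
by rewrite ffunE mulr0.
Qed.

Lemma levi_linear1 : phi 1 = 1.
Proof. by rewrite -ptens1 phiE levi_embed1. Qed.

Lemma levi_linearM : {morph phi : s t / s * t}.
Proof.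
move=> s t; elim/tensor_ind: s => [s1 s2 IH1 IH2|a y].
  by rewrite mulrDl !linearD /= IH1 IH2 mulrDl.
elim/tensor_ind: t => [s1 s2 IH1 IH2|b z].
  by rewrite mulrDr !linearD /= IH1 IH2 mulrDr.
rewrite -scalerAl -scalerAr ptensM !linearZ /= !phiE -scalerAl -scalerAr.
by rewrite levi_embedM.
Qed.

Lemma levi_linear_limg : limg (linfun phi) = hecke_span psi mu (levi F n mu).
Proof.
apply/eqP; rewrite eqEsubv; apply/andP; split.
  apply/subvP=> _ /memv_imgP[s _ ->]; rewrite lfunE /=.
  elim/tensor_ind: s => [s t IHs IHt|a y]; first by rewrite linearD memvD.
  rewrite linearZ phiE levi_embed_expand memvZ // memv_suml // => g _.
  by rewrite memvZ //; apply/memv_span/map_f; rewrite mem_enum block_diag_levi.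
apply/span_subvP => x /mapP[p]; rewrite mem_enum => pL ->{x}.
rewrite (levi_block_diag n_gt0 mu_comp pL) -levi_embed_heckeElt -phiE.
by rewrite -[phi _](lfunE phi) memv_img ?memvf.
Qed.

End LeviSubalgebra.

Theorem theorem9 (R : realType) (F : finFieldType) (psi : addchar F R[i])
    (psi_nontrivial : exists t : F, psi t <> 1)
    (n : nat) (mu : seq nat) (n_gt0 : (0 < n)%N)
    (mu_comp : is_composition n mu) :
  let H_ (i : 'I_(size mu)) : falgType R[i] :=
    heckeA psi (nth 0%N mu i) [:: nth 0%N mu i] in
  let T_ (i : 'I_(size mu)) (f : {poly F}) : H_ i :=
    heckeT psi (nth 0%N mu i) (nu := [:: nth 0%N mu i]) (const_mx f) in
  let on_basis (Phi : 'Hom(tensor H_, heckeA psi n mu)) : Prop :=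
    forall f : 'I_(size mu) -> {poly F},
      (forall i : 'I_(size mu), inM (nu := [:: nth 0%N mu i]) (const_mx (f i))) ->
      Phi (ptens (fun i => T_ i (f i))) = heckeT psi n (diag_poly f) in
  exists Phi : 'Hom(tensor H_, heckeA psi n mu),
    unique on_basis Phi /\
    [/\ injective Phi,
        Phi 1 = 1,
        {morph Phi : x y / x * y},
        limg Phi = hecke_span psi mu (parabolic F n mu)
      & hecke_span psi mu (parabolic F n mu) =
        hecke_span psi mu (levi F n mu)].
Proof.
move=> H_ T_ on_basis.
have [phi [phiE _]] :=
  tensor_universal (levi_embed_multilinear (psi := psi) n_gt0 mu_comp).
have PhiE s : linfun phi s = phi s by rewrite lfunE.
have Phi_basis : on_basis (linfun phi).
  move=> f fM; rewrite PhiE phiE levi_embed_heckeElt /heckeT.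
  by rewrite block_diag_vGL.
exists (linfun phi); split.
  split=> // Phi' Phi'_basis; apply/lfunP => s.
  (* By [hecke_expand] and [heckeElt_whittaker] these elements span [H_ i]. *)
  pose S i (h : H_ i) := exists2 f, inM (nu := [:: nth 0%N mu i]) (const_mx f) & h = T_ i f.
  apply: (tensor_linear_ext (S := S)) => [i Q Q0 QD h|x xS].
    rewrite (hecke_expand h); elim: (index_enum _) => [|g r IHr].
      by rewrite big_nil.
    have mu_i := block_size_gt0 mu_comp (ltn_ord i).
    have [f [a [fM gE]]] := heckeElt_whittaker g psi_nontrivial mu_i.
    by rewrite big_cons gE scalerA; apply: QD => //; exists f.
  have /all_sig2[f fM xE] (i : 'I_(size mu)) : {f : {poly F} |
      inM (nu := [:: nth 0%N mu i]) (const_mx f) & x i = T_ i f}.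
    by apply: cid2; have [f fM xE] := xS i; exists f.
  have -> : x = fun i => T_ i (f i) by apply: functional_extensionality_dep.
  by transitivity (heckeT psi n (diag_poly f)); [apply: Phi_basis|apply/esym/Phi'_basis].
have inj := levi_linear_inj phiE.
split.
- by move=> s t; rewrite !PhiE; apply: inj.
- by rewrite PhiE; apply: levi_linear1 phiE.
- by move=> s t; rewrite !PhiE; apply: (levi_linearM phiE).
- by rewrite hecke_span_parabolic //; apply: (levi_linear_limg phiE).
exact: hecke_span_parabolic.
Qed.
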